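(* Let $G$ be a 2-vertex-connected outerplanar graph, $t$ a positive integer, and $\tilde T,w,S$ as in the context. Given a tree S-partition $\pi$ of $\tilde T$ with $\mathrm{cost}(\pi)\le t-1$, a tree $t$-spanner of $G$ can be constructed in $O(|V(G)|)$ time.
   Context: Graphs are simple, finite, connected, undirected, unweighted. $G$ is embedded (uniquely) in the plane with all vertices on the boundary of the exterior face; bounded faces are interior faces, $\mathrm{Int\text{-}faces}(G)$ their set, $E(f)$ the edge set of a face $f$. An edge is external if on the exterior face; an E-face is an interior face containing an external edge. $\tilde T$ has vertex set $\{v_f: f\in\mathrm{Int\text{-}faces}(G)\}$ and edges $(v_f,v_g)$ whenever $|E(f)\cap E(g)|=1$; $w(v_f)=|E(f)|-2$; $S=\{v_f: f \text{ an E-face of } G\}$. A tree S-partition of $\tilde T$ is a partition $\pi=\{V_1,\ldots,V_{|S|}\}$ of $V(\tilde T)$ with each $\tilde T[V_i]$ a tree and $|V_i\cap S|=1$; $\mathrm{cost}(\pi)=\max_i\sum_{v\in V_i}w(v)$. A tree $t$-spanner of $G$ is a spanning tree $T$ with $d_T(u,v)\le t\cdot d_G(u,v)$ for all $u,v$. *)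

(* Defs.v *)
From mathcomp Require Import all_boot.

Set Implicit Arguments.
Unset Strict Implicit.
Unset Printing Implicit Defensive.

(** * Graphs *)

Section Graphs.
Variable T : finType.
Implicit Types (A : {set T}) (r : rel T).

Definition simple_graph r : Prop := symmetric r /\ irreflexive r.

Definition induced A r : rel T := [rel x y | [&& x \in A, y \in A & r x y]].

Definition connected_on A r : Prop :=
  {in A &, forall x y, connect (induced A r) x y}.

(* For a symmetric irreflexive [r], an edge [x -- y] is itself a [ucycle]
   [:: x; y]; the cycles of the graph are those of length at least 3. *)
Definition acyclic_on A r : Prop :=
  forall c : seq T, ucycle (induced A r) c -> size c <= 2.

Definition tree_on A r : Prop :=
  [/\ A != set0, connected_on A r & acyclic_on A r].

Definition two_connected r : Prop :=
  [/\ 2 < #|T|, connected_on setT r & forall x, connected_on [set~ x] r].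

(* The least length of a walk from [x] to [y]; the junk value [#|T|] when [y]
   is not reachable from [x]. *)
Definition gdist r (x y : T) : nat :=
  find (fun k => [exists p : k.-tuple T, path r x p && (last x p == y)])
       (iota 0 #|T|).

Definition darts r : {set T * T} := [set d | r d.1 d.2].

Definition edge_of (d : T * T) : {set T} := [set d.1; d.2].

Definition edges r : {set {set T}} := edge_of @: darts r.

Definition adj (F : {set {set T}}) : rel T := [rel x y | [set x; y] \in F].

Definition tree_spanner r (t : nat) (F : {set {set T}}) : Prop :=
  [/\ F \subset edges r,
      tree_on setT (adj F)
    & forall u v, gdist (adj F) u v <= t * gdist r u v].

End Graphs.

(** * Plane embeddings

   An embedding of a connected graph in the sphere is given, up to
   homeomorphism, by its rotation system: [rot u] is the cyclic order of the
   neighbours of [u] around [u].  A face is the set of darts met when walking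
   along its boundary, i.e. an orbit of [fstep rot], and the rotation system is
   that of a planar embedding iff Euler's formula holds.  A plane embedding
   is obtained by singling out one face as the exterior one. *)

Section Embedding.
Variable V : finType.
Variables (e : rel V) (rot : V -> V -> V).

(* [rot u] permutes the neighbours of [u] in a single cycle; its values
   elsewhere are irrelevant. *)
Definition rotation_system : Prop :=
  (forall u v, e u v -> e u (rot u v)) /\
  (forall u v w, e u v -> e u w -> fconnect (rot u) v w).

Definition fstep (d : V * V) : V * V := (d.2, rot d.2 d.1).

Definition face_of (d : V * V) : {set V * V} := [set d' | fconnect fstep d d'].

Definition faces : {set {set V * V}} := face_of @: darts e.

Definition face_edges (f : {set V * V}) : {set {set V}} := @edge_of V @: f.

Definition plane_embedding : Prop :=
  rotation_system /\ #|V| + #|faces| = #|edges e| + 2.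

Variable outer : {set V * V}.

Definition outerplane_embedding : Prop :=
  [/\ plane_embedding,
      outer \in faces
    & forall v, exists2 d, d \in outer & v \in edge_of d].

Definition int_faces : {set {set V * V}} := faces :\ outer.

Definition external_edges : {set {set V}} := face_edges outer.

(** * The weighted tree of interior faces; the vertex [v_f] is [f] itself *)

Definition dual_adj : rel {set V * V} :=
  [rel f g | [&& f \in int_faces, g \in int_faces, f != g
               & #|face_edges f :&: face_edges g| == 1]].

Definition weight (f : {set V * V}) : nat := #|face_edges f| - 2.

Definition E_faces : {set {set V * V}} :=
  [set f in int_faces | face_edges f :&: external_edges != set0].

Definition tree_S_partition (pi : {set {set {set V * V}}}) : Prop :=
  [/\ partition pi int_faces,
      #|pi| = #|E_faces|
    & forall A, A \in pi -> tree_on A dual_adj /\ #|A :&: E_faces| = 1].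

Definition cost (pi : {set {set {set V * V}}}) : nat :=
  \max_(A in pi) \sum_(f in A) weight f.

End Embedding.

(** * Random access machine

   Structured programs over finitely many registers and an addressable memory,
   with read-only input and write-only output tapes.  Each instruction and each
   test takes one unit of time.  [exec B c s k s']: started in [s], [c]
   terminates in [s'] after [k] units of time, all words held in registers
   and memory being at most [B] throughout. *)

Inductive instr : Type :=
| Const of nat & nat
| Add of nat & nat & nat
| Sub of nat & nat & nat
| Fetch of nat & nat
| Store of nat & nat
| Read of nat
| Write of nat.

Inductive com : Type :=
| Skip
| Do of instr
| Seq of com & com
| If of nat & com & com
| While of nat & com.

Record state : Type := State {
  reg : nat -> nat;
  mem : nat -> nat;
  inp : seq nat;
  out : seq nat }.

Definition upd (f : nat -> nat) (i v : nat) : nat -> nat :=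
  fun j => if j == i then v else f j.

Definition set_reg (s : state) (x v : nat) : state :=
  State (upd (reg s) x v) (mem s) (inp s) (out s).

Definition do_instr (i : instr) (s : state) : option state :=
  match i with
  | Const x k => Some (set_reg s x k)
  | Add x y z => Some (set_reg s x (reg s y + reg s z))
  | Sub x y z => Some (set_reg s x (reg s y - reg s z))
  | Fetch x y => Some (set_reg s x (mem s (reg s y)))
  | Store x y =>
      Some (State (reg s) (upd (mem s) (reg s x) (reg s y)) (inp s) (out s))
  | Read x =>
      if inp s is w :: ws then Some (State (upd (reg s) x w) (mem s) ws (out s))
      else None
  | Write x => Some (State (reg s) (mem s) (inp s) (rcons (out s) (reg s x)))
  end.

Definition fits (B : nat) (s : state) : Prop :=
  forall i, reg s i <= B /\ mem s i <= B.

Inductive exec (B : nat) : com -> state -> nat -> state -> Prop :=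
| exec_skip s : exec B Skip s 1 s
| exec_do i s s' :
    do_instr i s = Some s' -> fits B s' -> exec B (Do i) s 1 s'
| exec_seq c1 c2 s1 s2 s3 k1 k2 :
    exec B c1 s1 k1 s2 -> exec B c2 s2 k2 s3 ->
    exec B (Seq c1 c2) s1 (k1 + k2) s3
| exec_if_true x c1 c2 s s' k :
    reg s x != 0 -> exec B c1 s k s' -> exec B (If x c1 c2) s k.+1 s'
| exec_if_false x c1 c2 s s' k :
    reg s x = 0 -> exec B c2 s k s' -> exec B (If x c1 c2) s k.+1 s'
| exec_while_true x c s1 s2 s3 k1 k2 :
    reg s1 x != 0 -> exec B c s1 k1 s2 -> exec B (While x c) s2 k2 s3 ->
    exec B (While x c) s1 (k1 + k2).+1 s3
| exec_while_false x c s : reg s x = 0 -> exec B (While x c) s 1 s.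

Definition init (input : seq nat) : state :=
  State (fun=> 0) (fun=> 0) input [::].

(** * Input and output formats *)

Definition listing (T : finType) (A : {set T}) (s : seq T) : Prop :=
  uniq s /\ s =i A.

Definition listing2 (T : finType) (P : {set {set T}}) (ss : seq (seq T)) : Prop :=
  all uniq ss /\ listing P [seq [set x in s] | s <- ss].

Definition prefixed (X : Type) (enc : X -> seq nat) (s : seq X) : seq nat :=
  size s :: flatten [seq enc x | x <- s].

Definition pair_words (n : nat) (d : 'I_n * 'I_n) : seq nat :=
  [:: val d.1; val d.2].

Section Input.
Variable n : nat.
Implicit Type es : seq ('I_n * 'I_n).

(* An interior face is described by the edges on its boundary, each given by
   its rank in the list [es] of the edges of the graph. *)
Definition face_words es (s : seq {set 'I_n}) : seq nat :=
  prefixed (fun x => [:: index x [seq edge_of d | d <- es]]) s.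

(* The number of vertices, the list [es] of edges, and the list [ps] of parts,
   each a list of faces; [bd f] lists the edges of the face [f]. *)
Definition encode es (bd : {set 'I_n * 'I_n} -> seq {set 'I_n})
    (ps : seq (seq {set 'I_n * 'I_n})) : seq nat :=
  n :: prefixed (@pair_words n) es
    ++ prefixed (prefixed (fun f => face_words es (bd f))) ps.

End Input.

(* Main.v *)
Require Import Defs.
From mathcomp Require Import all_boot zify.

(** Delete from [G], for every part of the partition, the edges lying on two
    faces of the part and one external edge of its E-face.  The deleted edges
    are dual to a spanning tree of the dual graph rooted at the exterior face,
    whose branches at the root are the parts.  Going up from the leaves of this
    tree, the ends of a deleted edge are joined by undeleted edges of the faces
    of its part [A]; there are at most [1 + sum_(f in A) w(f) <= t] of these,
    since every tree edge inside [A] is deleted from two faces of [A].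
    So the remaining graph is connected, has stretch at most [t], and by Euler's
    formula has [n - 1] edges, i.e. is a tree.

    The same argument, with a dual forest rooted at a set of faces, shows that
    in a plane graph a set [X] of edges that only meets the faces in [R]
    disconnects the graph as soon as [#|R| <= #|X|].  Hence the two sides of an
    edge are different faces and two interior faces share at most one edge, so
    the external edges are those listed in one interior face only: one pass
    over the faces finds them, and the deleted inner edges, in linear time. *)

Set Implicit Arguments.
Unset Strict Implicit.
Unset Printing Implicit Defensive.

(** * Spanning trees and distances *)

(** Planarity is known only as Euler's formula for a rotation system, so no closed curve is
    available to separate anything. Separation is replaced by counting: a connected graph has at
    least [#|V| - 1] edges, while deleting the edges of a dual forest never disconnects. Letting the
    forest have a set [R] of roots makes one construction serve three ends: the exterior face alone
    gives the spanner, a single face shows that no face meets both sides of an edge, and two faces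
    bound the number of their common edges. The input hides the embedding: it has neither rotation
    nor exterior face, only the edge lists of the interior faces grouped by part. All that must be
    remembered about an edge while reading is condensed into one word, its label. Linear time rests
    on Euler's formula once more: in a 2-connected graph every face has at least three darts, whence
    at most [3 * n] edges, [2 * n] faces and a total boundary length of at most [6 * n]. *)

Section GraphFacts.
Variable T : finType.
Implicit Types (r : rel T) (F : {set {set T}}) (x y z : T) (p : seq T).

Lemma gdist_le r x p : path r x p -> gdist r x (last x p) <= size p.
Proof.
move=> pth; rewrite /gdist; set P := fun k : nat => _.
have Pp : P (size p) by apply/existsP; exists (in_tuple p); rewrite pth eqxx.
have [lt|ge] := ltnP (size p) #|T|; last first.
  by apply: leq_trans ge; rewrite -[X in _ <= X](size_iota 0) find_size.
rewrite leqNgt; apply/negP => /(before_find 0).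
by rewrite nth_iota // add0n Pp.
Qed.

Lemma gdist_walk r x y : connect r x y ->
  exists p, [/\ path r x p, last x p = y & size p = gdist r x y].
Proof.
case/connectP => q pth ->; case/shortenP: pth => p pth up _.
have lt : size p < #|T| by move/card_uniqP: up => /= <-; exact: max_card.
pose P := fun k => [exists q : k.-tuple T, path r x q && (last x q == last x p)].
have hP : has P (iota 0 #|T|).
  apply/hasP; exists (size p); first by rewrite mem_iota.
  by apply/existsP; exists (in_tuple p); rewrite pth eqxx.
have := nth_find 0 hP; rewrite nth_iota ?add0n; last by move: hP; rewrite has_find size_iota.
case/existsP => q' /andP[pq /eqP lq]; exists q'; split=> //.
by rewrite size_tuple.
Qed.

Lemma adjE F x y : adj F x y = ([set x; y] \in F).
Proof. by []. Qed.

Lemma adj_sym F : symmetric (adj F).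
Proof. by move=> x y; rewrite !adjE setUC. Qed.

Lemma connect_adjC F : connect_sym (adj F).
Proof. exact/sym_connect_sym/adj_sym. Qed.

Lemma connect_adjS F1 F2 : F1 \subset F2 ->
  subrel (connect (adj F1)) (connect (adj F2)).
Proof. by move=> /subsetP s; apply: connect_sub => x y /s h; apply: connect1. Qed.

Lemma path_adjD1 F x y z p : path (adj F) z p -> y \notin z :: p ->
  path (adj (F :\ [set x; y])) z p.
Proof.
elim: p z => //= w p IH z /andP[zw wp]; rewrite !inE !negb_or => /and3P[yz yw yp].
rewrite adjE !inE -adjE zw andbT IH ?inE ?negb_or ?yw ?andbT //.
apply/eqP => /setP/(_ y); rewrite !inE eqxx orbT.
by rewrite (negPf yz) (negPf yw).
Qed.

Lemma uniq_path_adj_size F x p : path (adj F) x p -> uniq (x :: p) ->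
  size p <= #|F|.
Proof.
elim: p x F => //= y p IH x F /andP[xy yp] /andP[xp up].
rewrite (cardsD1 [set x; y]) -adjE xy ltnS; apply: IH up.
by rewrite [[set x; y]]setUC; apply: path_adjD1.
Qed.

(** Turns connectivity within a small edge set into a short detour; the stretch bound comes from
    here. *)
Lemma connect_adj_path F x y : connect (adj F) x y ->
  exists p, [/\ path (adj F) x p, last x p = y & size p <= #|F|].
Proof.
case/connectP => q pth ->; case/shortenP: pth => p pth up _.
by exists p; split=> //; apply: uniq_path_adj_size up.
Qed.

Lemma gdist_parent r x y : connect r x y -> x != y ->
  exists z, [/\ r z y, connect r x z & gdist r x z < gdist r x y].
Proof.
case/gdist_walk => p [pth <- sz] xy.
case/lastP: p => [|p z] in pth xy sz *; first by rewrite eqxx in xy.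
move: pth sz; rewrite rcons_path last_rcons => /andP[pth lz] <-.
exists (last x p); split=> //; first by apply/connectP; exists p.
by rewrite size_rcons ltnS gdist_le.
Qed.

(** Each vertex other than [x0] is charged to the edge from its predecessor on a shortest walk from
    [x0]. Two vertices charged to one edge would each be the predecessor of the other, at a smaller
    distance. *)
Lemma connected_card F : (forall x y, connect (adj F) x y) -> #|T| <= #|F|.+1.
Proof.
move=> cF; have [-> //|/card_gt0P[x0 _]] := posnP #|T|.
have /fin_all_exists[par parP] y : exists z,
    x0 != y -> adj F z y && (gdist (adj F) x0 z < gdist (adj F) x0 y).
  have [|ny] := eqVneq x0 y; first by exists y.
  by have [z [h1 _ h2]] := gdist_parent (cF x0 y) ny; exists z; rewrite h1 h2.
rewrite -cardsT (cardsD1 x0) inE add1n ltnS.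
have inj : {in [set: T] :\ x0 &, injective (fun y => [set par y; y])}.
  move=> y z; rewrite !inE !andbT ![_ == x0]eq_sym.
  move=> /parP/andP[_ hy] /parP/andP[_ hz] eq; apply/eqP/negP => /negP yz.
  have /setP/(_ y) := eq; rewrite !inE eqxx orbT (negPf yz) orbF => /esym/eqP ey.
  have /setP/(_ z) := eq; rewrite !inE eqxx orbT [z == y]eq_sym (negPf yz) orbF.
  by move/eqP=> ez; move: hy hz; rewrite -ey -ez; lia.
rewrite -(card_in_imset inj); apply/subset_leq_card/subsetP => _ /imsetP[y + ->].
by rewrite !inE andbT eq_sym => /parP/andP[].
Qed.

Lemma connect_adjD1 F x y : connect (adj (F :\ [set x; y])) x y ->
  subrel (connect (adj F)) (connect (adj (F :\ [set x; y]))).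
Proof.
move=> cxy; apply: connect_sub => a b ab.
have [eq|ne] := eqVneq [set a; b] [set x; y]; last first.
  by apply: connect1; rewrite adjE !inE ne.
have [->|na] := eqVneq a b; first exact: connect0.
have /setP/(_ a) := eq; have /setP/(_ b) := eq; rewrite !inE !eqxx orbT /=.
case/esym/orP=> /eqP eb /esym/orP[] /eqP ea; move: na cxy; rewrite ea eb ?eqxx //.
by rewrite connect_adjC.
Qed.

Lemma inducedE A r x y : induced A r x y = [&& x \in A, y \in A & r x y].
Proof. by []. Qed.

Lemma induced_setT r : induced setT r =2 r.
Proof. by move=> x y; rewrite inducedE !inE. Qed.

Lemma connected_onT r : connected_on setT r <-> forall x y, connect r x y.
Proof.
split=> h x y; last by move=> _ _; rewrite (eq_connect (induced_setT r)).
by rewrite -(eq_connect (induced_setT r)); apply: h; rewrite inE.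
Qed.

(** An edge of a cycle is bypassed by the rest of the cycle, so deleting it would leave a connected
    graph with fewer than [#|T| - 1] edges. *)
Lemma tree_of_card F : 0 < #|T| -> (forall x y, connect (adj F) x y) ->
  #|F| < #|T| -> tree_on setT (adj F).
Proof.
move=> T0 cF szF; split; first by rewrite -card_gt0 cardsT.
  exact/connected_onT.
move=> c /andP[]; rewrite (eq_cycle (induced_setT _)).
case: c => [|x [|y [|z p]]] //=; rewrite !inE !negb_or rcons_path.
case/and4P=> xy yz zp px /and4P[/and3P[nxy nxz nxp] /andP[nyz nyp] _ _].
have cxy : connect (adj (F :\ [set x; y])) x y.
  rewrite connect_adjC; apply: (@connect_trans _ _ z).
    apply: connect1; rewrite adjE !inE -adjE yz andbT.
    apply/eqP => /setP/(_ z); rewrite !inE eqxx orbT.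
    by rewrite [z == x]eq_sym (negPf nxz) [z == y]eq_sym (negPf nyz).
  apply/connectP; exists (rcons p x); last by rewrite last_rcons.
  apply: path_adjD1; first by rewrite rcons_path zp.
  by rewrite !inE mem_rcons !inE !negb_or nyz [y == x]eq_sym nxy nyp.
have := @connected_card (F :\ [set x; y]) (fun a b => connect_adjD1 cxy (cF a b)).
by move: szF; rewrite (cardsD1 [set x; y] F) -adjE xy add1n => h1 /(leq_trans h1); rewrite ltnn.
Qed.

Lemma spanner_of_edges r F t : (forall x y, connect r x y) ->
  (forall x y, r x y -> exists p, [/\ path (adj F) x p, last x p = y & size p <= t]) ->
  forall u v, gdist (adj F) u v <= t * gdist r u v.
Proof.
move=> cr hF u v; have [q [pq <- <-]] := gdist_walk (cr u v).
suff [p [pp <- sp]] : exists p, [/\ path (adj F) u p, last u p = last u q & size p <= t * size q].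
  exact: leq_trans (gdist_le pp) sp.
elim: q u pq => [|w q IH] u /=; first by exists [::].
case/andP=> /hF[p1 [pp1 l1 s1]] /IH[p2 [pp2 l2 s2]]; exists (p1 ++ p2).
by rewrite cat_path last_cat size_cat pp1 l1 l2 pp2 mulnS; split=> //; apply: leq_add.
Qed.

(** Otherwise a simple [P]-path from [x] to [y] has at least two steps and closes with the edge to a
    forbidden cycle. This will show that the parent edges exhaust the dual tree of a part. *)
Lemma acyclic_edge A r (P : rel T) x y : symmetric r -> acyclic_on A r ->
  subrel P (induced A r) -> connect P x y -> induced A r x y -> x != y -> P x y.
Proof.
move=> sr ac sP /connectP[q pth ey] rxy ne; move: pth ey rxy ne.
case/shortenP=> p pth up _ ->.
case: p pth up => [|z [|w p]] /=; rewrite ?eqxx // ?andbT //.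
move=> pth up rxy _; have := ac (x :: z :: w :: p); rewrite /ucycle [uniq _]up andbT.
suff -> : cycle (induced A r) (x :: z :: w :: p) by move/(_ isT).
rewrite /= -cats1 cat_path /= andbT.
case/and3P: pth => /sP -> /sP -> /(sub_path sP) -> /=.
by move: rxy; rewrite !inducedE sr => /and3P[-> -> ->].
Qed.

End GraphFacts.

(** * Faces of a rotation system *)

Section Faces.
Variables (V : finType) (e : rel V) (rot : V -> V -> V).
Hypothesis simple_e : simple_graph e.
Hypothesis rot_e : rotation_system e rot.
Implicit Types (d : V * V) (f g : {set V * V}) (x : {set V}).

Definition flip d := (d.2, d.1).

Let e_sym : symmetric e := proj1 simple_e.
Let e_irr : irreflexive e := proj2 simple_e.
Let face := face_of rot.
Let step := fstep rot.

Lemma edge_of_flip d : edge_of (flip d) = edge_of d.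
Proof. by rewrite /edge_of /= setUC. Qed.

Lemma flipK d : flip (flip d) = d.
Proof. by case: d. Qed.

Lemma edge_of_eq d d' : edge_of d = edge_of d' -> d' = d \/ d' = flip d.
Proof.
case: d d' => [a b] [a' b']; rewrite /edge_of /flip /= => /setP eq.
have := eq a; have := eq b; have := eq a'; have := eq b'; rewrite !inE !eqxx ?orbT /=.
move=> /orP[] /eqP -> /orP[] /eqP ->; rewrite ?eqxx ?orbF ?orbb; auto.
- by move=> /esym/eqP -> _; left.
- by move=> _ /esym/eqP ->; left.
Qed.

Lemma darts_flip d : (flip d \in darts e) = (d \in darts e).
Proof. by rewrite !inE /= e_sym. Qed.

Lemma dart_neq d : d \in darts e -> d.1 != d.2.
Proof. by rewrite inE; apply: contraTneq => ->; rewrite e_irr. Qed.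

Lemma edges_dart d : (edge_of d \in edges e) = (d \in darts e).
Proof.
apply/imsetP/idP => [[d' d'D /edge_of_eq[<-//|eq]]|dD]; last by exists d.
by rewrite -darts_flip -eq.
Qed.

Lemma fstep_dart : {homo step : d / d \in darts e}.
Proof. by move=> d; rewrite !inE /= e_sym => /(proj1 rot_e). Qed.

(** The single cycle makes [rot u] surjective on the neighbours of [u], as the orbit of [rot u v]
    returns to [v]; finiteness gives injectivity. *)
Lemma rot_inj u : {in e u &, injective (rot u)}.
Proof.
have clos : {homo rot u : v / v \in e u} by move=> v; apply: (proj1 rot_e).
suff /imset_injP : #|rot u @: [set v | e u v]| == #|[set v | e u v]|.
  by move=> h v w vN wN; apply: h; rewrite inE.
rewrite eqn_leq leq_imset_card; apply/subset_leq_card/subsetP => v; rewrite inE => vN.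
have /connectP[p pth ev] : fconnect (rot u) (rot u v) v.
  by apply: (proj2 rot_e) => //; apply: clos.
case/lastP: p pth ev => [|p w] /=.
  by move=> _ ev; apply/imsetP; exists v; rewrite ?inE.
rewrite rcons_path last_rcons => /andP[pth /eqP ew] ev; apply/imsetP.
exists (last (rot u v) p); last by rewrite ew.
rewrite inE; elim: p (rot u v) (clos _ vN) pth {ew} => //= a p IH b bN /andP[/eqP <-].
by apply: IH; apply: clos.
Qed.

Lemma fstep_inj : {in darts e &, injective step}.
Proof.
move=> [a b] [a' b']; rewrite !inE /= [e a b]e_sym [e a' b']e_sym => ab a'b' [eb].
by move: a'b'; rewrite -eb => a'b' /rot_inj ->.
Qed.

Lemma face_id d : d \in face d.
Proof. by rewrite inE connect0. Qed.

Lemma face_dart d d' : d \in darts e -> d' \in face d -> d' \in darts e.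
Proof.
move=> dD; rewrite inE => /connectP[p pth ->] {d'}.
by elim: p d dD pth => //= d' p IH d /fstep_dart dD /andP[/eqP <-]; apply: IH.
Qed.

Lemma face_eq d d' : d \in darts e -> d' \in face d -> face d' = face d.
Proof.
move=> dD d'f; have d'D := face_dart dD d'f; rewrite inE in d'f.
have sym := fconnect_sym_in fstep_dart fstep_inj.
have d'd : fconnect step d' d by rewrite sym.
by apply/setP => c; rewrite !inE; apply/idP/idP; apply: connect_trans.
Qed.

Lemma face_fstep d : d \in darts e -> face (step d) = face d.
Proof. by move=> dD; apply: face_eq => //; rewrite inE fconnect1. Qed.

Lemma face_in_faces d : d \in darts e -> face d \in faces e rot.
Proof. exact: imset_f. Qed.

Lemma facesP f d : f \in faces e rot -> d \in f -> d \in darts e /\ f = face d.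
Proof.
case/imsetP => c cD -> df; split; first exact: face_dart df.
by rewrite [RHS](face_eq cD df).
Qed.

Lemma face_edgesP f x : f \in faces e rot ->
  reflect (exists2 d, d \in darts e & f = face d /\ x = edge_of d) (x \in face_edges f).
Proof.
move=> fF; apply: (iffP imsetP) => [[d df ->]|[d dD [-> ->]]].
  by have [dD ->] := facesP fF df; exists d.
by exists d => //; apply: face_id.
Qed.

Lemma face_edges_sub f : f \in faces e rot -> face_edges f \subset edges e.
Proof.
by move=> fF; apply/subsetP => _ /(face_edgesP _ fF)[d dD [_ ->]]; rewrite edges_dart.
Qed.

Lemma face_edges_dart f d : f \in faces e rot -> edge_of d \in face_edges f ->
  f = face d \/ f = face (flip d).
Proof. by move=> fF /(face_edgesP _ fF)[c _ [-> /edge_of_eq[->|->]]]; auto. Qed.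

(** Follow the face from [step d] until it returns to [d]. Without repetition [d] is met only at the
    end, and no other dart of the face carries its edge, since the opposite dart lies elsewhere. *)
Lemma boundary_walk d : d \in darts e -> flip d \notin face d ->
  connect (adj (face_edges (face d) :\ edge_of d)) d.2 d.1.
Proof.
move=> dD nf; have /connectP[q pth] : fconnect step (step d) d.
  by rewrite (fconnect_sym_in fstep_dart fstep_inj) ?fconnect1 ?fstep_dart.
case/shortenP: pth => p pth up _ ed.
have : step d \in face d by rewrite inE fconnect1.
rewrite -[d.2]/((step d).1); move: ed pth up.
elim: p (step d) => [|c' p IH] c /=; first by move=> -> *; apply: connect0.
move=> ed /andP[/eqP ec pth] /andP[cp up] cf.
have c'f : c' \in face d.
  by move: cf; rewrite !inE -ec => cf; apply: connect_trans cf (fconnect1 _ _).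
apply: connect_trans (IH _ ed pth up c'f); rewrite -ec; apply: connect1.
rewrite adjE -/(edge_of c) !inE (imset_f _ cf) andbT.
apply: contra cp => /eqP/edge_of_eq[<-|eq]; first by rewrite ed mem_last.
by move: nf; rewrite {1}eq flipK cf.
Qed.

Lemma face_connected d d' : d \in darts e -> d' \in face d ->
  connect (adj (face_edges (face d))) d.1 d'.1.
Proof.
move=> dD; rewrite [_ \in _]inE => /connectP[p pth ->] {d'}.
suff h c : c \in face d -> fpath step c p ->
    connect (adj (face_edges (face d))) c.1 (last c p).1 by apply: h (face_id d) _.
elim: p c {pth} => [|c' p IH] c cf /=; first by [].
case/andP=> /eqP ec pth; apply: connect_trans (IH _ _ pth).
  by rewrite -ec; apply: connect1; rewrite adjE -/(edge_of c) (imset_f _ cf).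
by move: cf; rewrite !inE -ec => cf; apply: connect_trans cf (fconnect1 _ _).
Qed.

Lemma face_connected_vertices f u v : f \in faces e rot ->
  (forall w, exists2 d, d \in f & w \in edge_of d) ->
  connect (adj (face_edges f)) u v.
Proof.
move=> fF cov; have [c cD ef] := imsetP fF.
suff h w : connect (adj (face_edges f)) c.1 w.
  by apply: connect_trans (h v); rewrite connect_adjC.
have [d df] := cov w; have := df; rewrite {1}ef => /(face_connected cD); rewrite -[face c]ef.
move=> cd; rewrite !inE => /orP[]/eqP -> //; apply: connect_trans cd _.
by apply: connect1; rewrite adjE -/(edge_of d) imset_f.
Qed.

(** Connectedness of the dual graph. Crossing an edge and then taking a step along the face turns
    around a vertex, so one face at a vertex brings in all faces there; walks in the graph carry
    this to every vertex. *)
Lemma faces_closed_full (S : {set {set V * V}}) d :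
  (forall u v, connect e u v) -> d \in darts e -> face d \in S ->
  (forall c, c \in darts e -> face c \in S -> face (flip c) \in S) ->
  faces e rot \subset S.
Proof.
move=> conn dD dS flipS.
have around u v w : e u v -> e u w -> face (u, v) \in S -> face (u, w) \in S.
  move=> uv uw; have /connectP[p pth ->] := proj2 rot_e _ _ _ uv uw.
  elim: p v uv pth => //= v' p IH v uv /andP[/eqP ev pth] vS.
  apply: IH pth _; first by rewrite -ev; apply: (proj1 rot_e).
  have vuD : (v, u) \in darts e by rewrite inE /= e_sym.
  rewrite -ev -[(u, _)]/(step (v, u)) face_fstep //.
  by apply: (flipS (u, v)) => //; rewrite inE.
suff full u w : e u w -> face (u, w) \in S.
  by apply/subsetP => _ /imsetP[[u w] uw ->]; apply: full; rewrite inE in uw.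
have /connectP[p pth ->] := conn d.1 u; move: dD dS; rewrite inE.
case: d pth => u0 v /=; elim: p u0 v w => [|u' p IH] u0 v w /=.
  by move=> _ uv uS uw; apply: around uS.
case/andP=> uu' pth uv uS; apply: IH pth _ _; first by rewrite e_sym; exact: uu'.
by apply: (flipS (u0, u')); rewrite ?inE //; apply: around uS.
Qed.

(** * Dual forests and the graph that remains without their edges *)

Section Cotree.
Variables (R : {set {set V * V}}) (pd : {set V * V} -> V * V) (h : {set V * V} -> nat).
Let par f := face (flip (pd f)).
Hypothesis pdP : forall f, f \in faces e rot :\: R ->
  pd f \in f /\ (par f \in R \/ h (par f) < h f).

(** [pd f] is the dart of [f] whose edge leads to the parent face, and [h] forces every chain of
    parents to end in the roots [R]. *)
Definition tree_edges := [set edge_of (pd f) | f in faces e rot :\: R].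

Lemma pd_dart f : f \in faces e rot :\: R -> pd f \in darts e /\ face (pd f) = f.
Proof.
by move=> fF; have [pf _] := pdP fF; move: fF => /setDP[fF _]; have [] := facesP fF pf.
Qed.

(** Two faces with a common parent edge would be parents of each other, and [h] would decrease both
    ways. *)
Lemma tree_edge_inj : {in faces e rot :\: R &, injective (fun f => edge_of (pd f))}.
Proof.
move=> f g fF gF /edge_of_eq[] eq.
  by have [_ <-] := pd_dart fF; have [_ <-] := pd_dart gF; rewrite eq.
have pf : par f = g by rewrite /par -eq; have [] := pd_dart gF.
have pg : par g = f by rewrite /par eq flipK; have [] := pd_dart fF.
have [_] := pdP fF; have [_] := pdP gF; rewrite pf pg.
move: fF gF => /setDP[_ /negPf->] /setDP[_ /negPf->].
by case=> // h1 [] // h2; have := ltn_trans h1 h2; rewrite ltnn.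
Qed.

Lemma card_tree_edges : R \subset faces e rot -> #|tree_edges| + #|R| = #|faces e rot|.
Proof. by move=> sR; rewrite (card_in_imset tree_edge_inj) cardsDS ?subnK ?subset_leq_card. Qed.

Lemma tree_edges_sub : tree_edges \subset edges e.
Proof.
by apply/subsetP=> _ /imsetP[f fF ->]; rewrite edges_dart; have [] := pd_dart fF.
Qed.

Lemma par_neq f : f \in faces e rot :\: R -> par f != f.
Proof.
move=> fF; have [_] := pdP fF; move: fF => /setDP[_ fR].
case=> [pR|]; first by apply: contraNneq fR => <-.
by apply: contraTneq => ->; rewrite ltnn.
Qed.

(* Induction from the leaves: the boundary of [f] minus the edge to its parent
   is a walk whose only tree edges lead to children of [f]. *)
Lemma tree_edge_bypass (A : {set {set V * V}}) f :
  A \subset faces e rot :\: R ->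
  (forall g, g \in faces e rot :\: R -> par g \in A -> g \in A) ->
  f \in A ->
  connect (adj (\bigcup_(g in A) face_edges g :\: tree_edges)) (pd f).2 (pd f).1.
Proof.
move=> /subsetP sA clA; set M := \max_g h g.
have hM g : h g <= M by apply: leq_bigmax.
have [k] := ubnP (M - h f); elim: k f => // k IH f lek fA.
have fF := sA _ fA; have [pD pf] := pd_dart fF.
have nf : flip (pd f) \notin face (pd f).
  apply: contra (par_neq fF) => ff; rewrite /par -{2}pf; apply/eqP.
  exact: face_eq ff.
apply: connect_sub (boundary_walk pD nf); rewrite pf => a b.
rewrite adjE !inE => /andP[ne abf].
have [abT|abT] := boolP ([set a; b] \in tree_edges); last first.
  by apply: connect1; rewrite adjE inE abT; apply/bigcupP; exists f.
have [g gF eg] := imsetP abT; have [gD pg] := pd_dart gF.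
have fF' : f \in faces e rot by case/setDP: fF.
have fp : par g = f.
  have := abf; rewrite eg => /(face_edges_dart fF')[] // e1.
  by move: ne; rewrite eg e1 pg eqxx.
have gA : g \in A by apply: clA; rewrite ?fp.
have [_ []] := pdP gF; rewrite fp; first by case/setDP: fF => _ /negPf->.
move=> lth; have /IH/(_ gA) cg : M - h g < k by have := hM g; lia.
have [ea|ea] := @edge_of_eq (pd g) (a, b) (esym eg).
  by move: cg; rewrite -ea connect_adjC.
by case: ea => -> ->.
Qed.

(** Each tree edge is bypassed along faces outside [R], and the boundaries of these faces contain no
    edge of [X]. *)
Lemma cotree_connected (X : {set {set V}}) :
  (forall d, d \in darts e -> edge_of d \in X -> face d \in R) ->
  (forall u v, connect (adj (edges e :\: X)) u v) ->
  forall u v, connect (adj (edges e :\: X :\: tree_edges)) u v.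
Proof.
move=> XR conn u v; apply: connect_sub (conn u v) => a b; rewrite adjE => abX.
have [abT|abT] := boolP ([set a; b] \in tree_edges); last first.
  by apply: connect1; rewrite adjE inE abT.
have [f fF ef] := imsetP abT.
have byp : connect (adj (edges e :\: X :\: tree_edges)) (pd f).2 (pd f).1.
  apply: connect_adjS (@tree_edge_bypass (faces e rot :\: R) f _ _ fF) => //.
  apply/setSD/bigcupsP => g /setDP[gF gR]; apply/subsetP => x xg.
  rewrite inE (subsetP (face_edges_sub gF)) // andbT.
  by case/(face_edgesP _ gF): xg gR => d dD [-> ->]; apply: contra; apply: XR.
have [ea|ea] := @edge_of_eq (pd f) (a, b) (esym ef).
  by move: byp; rewrite -ea connect_adjC.
by case: ea => -> ->.
Qed.

End Cotree.

Lemma dual_forest (R : {set {set V * V}}) : (forall u v, connect e u v) ->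
  R \subset faces e rot -> R != set0 -> exists pd (h : {set V * V} -> nat),
  forall f, f \in faces e rot :\: R -> pd f \in f /\
    (face (flip (pd f)) \in R \/ h (face (flip (pd f))) < h f).
Proof.
move=> conn sR /set0Pn[r0 r0R]; have [d0 d0D er0] := imsetP (subsetP sR _ r0R).
(* Breadth-first search in the dual graph. Each face of [R] is one arc away from every face, so [R]
   acts as a single root; a face outside [R] can only be entered across an edge. *)
pose r := [rel f g | (g \in R) ||
  [exists d, [&& d \in darts e, face d == g & face (flip d) == f]]].
have /subsetP reach : faces e rot \subset [set f | connect r r0 f].
  apply: (faces_closed_full conn d0D) => [|c cD]; rewrite !inE.
    by rewrite -[face d0]er0 connect0.
  move=> /connect_trans-> //; apply: connect1; apply/orP; right; apply/existsP.
  by exists (flip c); rewrite darts_flip cD flipK !eqxx.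
suff /fin_all_exists[pd pdP] f : exists d, f \in faces e rot :\: R ->
    (d \in f) && (gdist r r0 (face (flip d)) < gdist r r0 f).
  by exists pd, (gdist r r0) => f /pdP/andP[-> ->]; auto.
have [/setDP[fF fR]|] := boolP (f \in _ :\: R); last by exists d0.
have ne : r0 != f by apply: contraNneq fR => <-.
have := reach _ fF; rewrite inE => /gdist_parent/(_ ne)[z [rz _ lt]].
case/orP: rz => [fR'|/existsP[d /and3P[dD /eqP ef /eqP ez]]].
  by rewrite fR' in fR.
by exists d => _; rewrite ez lt -ef face_id.
Qed.

(* In the plane, cutting along the edges of [X] glues their faces into at most
   [#|R|] discs, so by Euler's formula [X] disconnects the graph as soon as
   [#|R| <= #|X|]. *)
Lemma connected_cut_card (R : {set {set V * V}}) (X : {set {set V}}) :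
  #|V| + #|faces e rot| = #|edges e| + 2 -> (forall u v, connect e u v) ->
  R \subset faces e rot -> R != set0 -> X \subset edges e ->
  (forall d, d \in darts e -> edge_of d \in X -> face d \in R) ->
  (forall u v, connect (adj (edges e :\: X)) u v) -> #|X| < #|R|.
Proof.
move=> euler conn sR R0 sX XR connX.
have [pd [h pdP]] := dual_forest conn sR R0.
have := connected_card (cotree_connected pdP XR connX).
have cD := card_tree_edges pdP sR; set D := tree_edges R pd in cD *.
have sDX : D \subset edges e :\: X.
  apply/subsetP => x xD; rewrite inE (subsetP (tree_edges_sub pdP) _ xD) andbT.
  have [f fF ->] := imsetP xD; have [pD pf] := pd_dart pdP fF.
  by apply/negP => /(XR _ pD); rewrite pf; case/setDP: fF => _ /negPf->.
rewrite cardsDS // cardsDS //.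
have := subset_leq_card sDX; rewrite cardsDS //; have := subset_leq_card sX.
have arith (d r f v m x : nat) : d + r = f -> v + f = m + 2 -> x <= m -> d <= m - x ->
  v <= (m - x - d).+1 -> x < r by lia.
exact: arith cD euler.
Qed.

Lemma connect_edges u v : connect (adj (edges e)) u v = connect e u v.
Proof.
apply: eq_connect => a b; rewrite adjE -[[set a; b]]/(edge_of (a, b)) edges_dart.
by rewrite inE.
Qed.

(** * Faces of a 2-connected plane graph: incidences and linear size bounds *)

Hypothesis conn2 : two_connected e.
Hypothesis euler : #|V| + #|faces e rot| = #|edges e| + 2.

Lemma two_connected_connect u v : connect e u v.
Proof. by have [_ /connected_onT + _] := conn2; apply. Qed.

Lemma third_vertex (u v : V) : exists w, (w != u) && (w != v).
Proof.
have [n2 _ _] := conn2; have /card_gt0P[w] : 0 < #|~: [set u; v]|.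
  rewrite -(cardsC [set u; v]) cards2 in n2.
  by move: n2; case: (u != v); case: #|_|.
by rewrite !inE negb_or; exists w.
Qed.

(** If both sides were one face, the cut bound for this face and this edge would read [1 < 1],
    because an edge of a 2-connected graph is not a bridge. *)
Lemma face_flip d : d \in darts e -> face (flip d) != face d.
Proof.
move=> dD; have [n2 _ c1] := conn2; apply/eqP => ff.
have := @connected_cut_card [set face d] [set edge_of d] euler two_connected_connect.
rewrite !cards1 ltnn => cut; apply/notF/cut.
- by rewrite sub1set face_in_faces.
- by apply/set0Pn; exists (face d); rewrite set11.
- by rewrite sub1set edges_dart.
- move=> c cD; rewrite !inE => /eqP/esym/edge_of_eq[->|->] //.
  by rewrite ff.
have avoid a b u v : edge_of d = [set a; b] -> u != a -> v != a ->
    connect (adj (edges e :\ edge_of d)) u v.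
  move=> ed ua va; have := c1 a u v; rewrite !inE => /(_ ua va).
  apply: connect_sub => y z /and3P[]; rewrite !inE => ya za yz; apply: connect1.
  rewrite adjE !inE -[[set y; z]]/(edge_of (y, z)) edges_dart inE yz andbT ed.
  by apply/eqP => /setP/(_ a); rewrite !inE eqxx ![a == _]eq_sym (negPf ya) (negPf za).
(* A third vertex [w] is reached from [d.1] avoiding [d.2], and [d.2] is reached from [w] avoiding
   [d.1]; neither walk can use the edge. *)
have [w /andP[w1 w2]] := third_vertex d.1 d.2; have n12 := dart_neq dD.
have c12 : connect (adj (edges e :\ edge_of d)) d.1 d.2.
  apply: (@connect_trans _ _ w).
    by apply: (@avoid d.2 d.1) => //; rewrite /edge_of setUC.
  by apply: (@avoid d.1 d.2) => //; rewrite eq_sym.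
by move=> u v; apply: connect_adjD1 => //; rewrite connect_edges two_connected_connect.
Qed.

Lemma face_edges_flip f d : d \in darts e -> f \in faces e rot -> d \notin f ->
  edge_of d \in face_edges f -> face (flip d) = f.
Proof.
by move=> dD fF df /(face_edges_dart fF)[] // ef; move: df; rewrite ef face_id.
Qed.

(** The sides of a common edge are [f] and [g], so such an edge is not on the exterior face, whose
    boundary passes through every vertex and keeps the graph connected. For two common edges the cut
    bound would read [2 < 2]. *)
Lemma face_edgesI_card (outer f g : {set V * V}) : outer \in faces e rot ->
  (forall w, exists2 d, d \in outer & w \in edge_of d) ->
  f \in int_faces e rot outer -> g \in int_faces e rot outer -> f != g ->
  #|face_edges f :&: face_edges g| <= 1.
Proof.
move=> oF cov /setD1P[fo fF] /setD1P[go gF] fg; rewrite leqNgt; apply/negP.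
case/card_gt1P => x [y [xI yI xy]].
have := @connected_cut_card [set f; g] [set x; y] euler two_connected_connect.
rewrite !cards2 fg xy ltnn => cut; apply/notF/cut.
- by apply/subsetP => k; rewrite !inE => /orP[] /eqP ->.
- by apply/set0Pn; exists f; rewrite !inE eqxx.
- apply/subsetP => z; rewrite !inE => zxy; apply: (subsetP (face_edges_sub fF)).
  by case/orP: zxy => /eqP ->; [case/setIP: xI | case/setIP: yI].
- move=> d dD dxy.
  have /setIP[df dg] : edge_of d \in face_edges f :&: face_edges g.
    by move: dxy; rewrite !inE => /orP[]/eqP->; rewrite -in_setI.
  case: (face_edges_dart fF df) => e1; first by rewrite e1 !inE eqxx.
  case: (face_edges_dart gF dg) => e2; first by rewrite e2 !inE eqxx orbT.
  by move: fg; rewrite e1 e2 eqxx.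
move=> u v; apply: connect_adjS (face_connected_vertices u v oF cov).
apply/subsetP => z zo; rewrite inE (subsetP (face_edges_sub oF)) // andbT.
apply/negP => zxy; have /setIP[zf zg] : z \in face_edges f :&: face_edges g.
  by move: zxy; rewrite !inE => /orP[]/eqP->; rewrite -in_setI.
have [d dD [ed ez]] := face_edgesP _ oF zo; move: zf zg; rewrite ez.
move=> /(face_edges_dart fF)[] e1; first by move: fo; rewrite e1 ed eqxx.
move=> /(face_edges_dart gF)[] e2; first by move: go; rewrite e2 ed eqxx.
by move: fg; rewrite e1 e2 eqxx.
Qed.

(** A fixed point of [rot u] would be the only neighbour of [u], hence a cut vertex. *)
Lemma rot_neq u v : e u v -> rot u v != v.
Proof.
move=> uv; apply/eqP => fix_v; have [_ _ c1] := conn2.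
have [w /andP[wu wv]] := third_vertex u v.
have uv' : u != v by have := @dart_neq (u, v); rewrite inE; apply.
have := c1 v u w; rewrite !inE => /(_ uv' wv) /connectP[[|z p] /=].
  by move=> _ ew; rewrite ew eqxx in wu.
rewrite inducedE !inE => /andP[/and3P[_ zv uz] _ _].
have /connectP[q pth ez] := proj2 rot_e _ _ _ uv uz.
move/eqP: zv; apply; rewrite ez; elim: q pth {ez} => //= a q IH /andP[/eqP <-].
by rewrite fix_v.
Qed.

(** Three consecutive darts of a face start at distinct vertices: the first and the third differ by
    [rot_neq], consecutive ones because there are no loops. *)
Lemma face_card f : f \in faces e rot -> 2 < #|f|.
Proof.
case/imsetP => d dD ->; apply/card_gt2P.
have d1D := fstep_dart dD.
exists d, (step d), (step (step d)); split.
- by rewrite !inE connect0 fconnect1 (connect_trans (fconnect1 _ _) (fconnect1 _ _)).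
have [n01 n12] := (dart_neq dD, dart_neq d1D); move: dD; rewrite inE => dD.
split; apply/eqP => /(congr1 fst) /=; first by apply/eqP.
- exact/eqP.
by apply/eqP; rewrite rot_neq // e_sym.
Qed.

Lemma faces_partition : partition (faces e rot) (darts e).
Proof.
apply/and3P; split.
- rewrite eqEsubset; apply/andP; split; apply/subsetP => d.
    by case/bigcupP => f fF df; have [] := facesP fF df.
  by move=> dD; apply/bigcupP; exists (face d); rewrite ?face_id ?face_in_faces.
- apply/trivIsetP => f g fF gF; apply: contraNT => /pred0Pn[d /andP[/= df dg]].
  by have [_ ->] := facesP fF df; have [_ <-] := facesP gF dg.
by apply/negP => /face_card; rewrite cards0.
Qed.

Lemma darts_card : #|darts e| <= #|edges e| * 2.
Proof.
rewrite -sum1_card (partition_big_imset (@edge_of V)) /= -sum_nat_const.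
apply: leq_sum => x /imsetP[d dD ->]; rewrite sum1dep_card.
apply: (@leq_trans #|[set d; flip d]|); last by rewrite cards2; case: (_ != _).
apply/subset_leq_card/subsetP => c; rewrite !inE => /andP[_ /eqP/esym/edge_of_eq].
by case=> ->; rewrite eqxx ?orbT.
Qed.

Lemma faces_darts_sum : \sum_(f in faces e rot) #|f| = #|darts e|.
Proof. by rewrite (card_partition faces_partition). Qed.

Lemma faces_edges_card : #|faces e rot| * 3 <= #|edges e| * 2.
Proof.
apply: leq_trans darts_card; rewrite -faces_darts_sum -sum_nat_const.
by apply: leq_sum => f /face_card.
Qed.

Lemma edges_card : #|edges e| <= 3 * #|V|.
Proof.
have arith (f m v : nat) : v + f = m + 2 -> f * 3 <= m * 2 -> m <= 3 * v by lia.
exact: arith euler faces_edges_card.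
Qed.

Lemma face_edges_sum (P : {set {set V * V}}) : P \subset faces e rot ->
  \sum_(f in P) #|face_edges f| <= 6 * #|V|.
Proof.
move=> sP; apply: (@leq_trans #|darts e|); last first.
  apply: leq_trans darts_card _; rewrite -[6]/(3 * 2) mulnAC leq_mul2r /=.
  exact: edges_card.
rewrite -faces_darts_sum [leqRHS](big_setID P) /= (setIidPr sP).
apply: leq_trans (leq_addr _ _); apply: leq_sum => f _; exact: leq_imset_card.
Qed.

Lemma faces_card : #|faces e rot| <= 2 * #|V|.
Proof.
have arith (f m v : nat) : v + f = m + 2 -> f * 3 <= m * 2 -> f <= 2 * v by lia.
exact: arith euler faces_edges_card.
Qed.

End Faces.

(** * The spanner *)

Lemma card_bigcup_le (I T : finType) (A : {set I}) (F : I -> {set T}) :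
  #|\bigcup_(i in A) F i| <= \sum_(i in A) #|F i|.
Proof.
apply: (big_ind2 (fun (B : {set T}) k => #|B| <= k)) => [|B1 k1 B2 k2 h1 h2|//].
  by rewrite cards0.
by apply: leq_trans (leq_add h1 h2); rewrite -cardsUI leq_addr.
Qed.

Lemma card_sep_sum (I : finType) (A : {set I}) (P : pred I) :
  #|[set i in A | P i]| = \sum_(i in A) P i.
Proof.
rewrite -sum1dep_card big_mkcondr; apply: eq_bigr => i _; by case: (P i).
Qed.

Section Spanner.
Variables (V : finType) (e : rel V) (rot : V -> V -> V) (outer : {set V * V}).
Hypothesis simple_e : simple_graph e.
Hypothesis conn2 : two_connected e.
Hypothesis outerplane_e : outerplane_embedding e rot outer.
Variables (pi : {set {set {set V * V}}}) (ext : {set {set V * V}} -> {set V}).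
Hypothesis pi_partition : partition pi (int_faces e rot outer).
Hypothesis pi_tree : forall A, A \in pi -> tree_on A (dual_adj e rot outer).
Hypothesis extP : forall A, A \in pi ->
  exists2 f, f \in A & ext A \in face_edges f :&: face_edges outer.

Let rot_e : rotation_system e rot.
Proof. by have [[]] := outerplane_e. Qed.
Let euler : #|V| + #|faces e rot| = #|edges e| + 2.
Proof. by have [[]] := outerplane_e. Qed.
Let outerF : outer \in faces e rot.
Proof. by have [] := outerplane_e. Qed.
Let outer_cover v : exists2 d, d \in outer & v \in edge_of d.
Proof. by have [_ _] := outerplane_e; apply. Qed.

Let face := face_of rot.
Let int := int_faces e rot outer.
Let dual := dual_adj e rot outer.

Definition shared_edges (A : {set {set V * V}}) : {set {set V}} :=
  [set x | [exists f in A, exists g in A,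
     (f != g) && (x \in face_edges f :&: face_edges g)]].

Definition removed_edges : {set {set V}} :=
  \bigcup_(A in pi) (ext A |: shared_edges A).

Let int_faces_sub f : f \in int -> f \in faces e rot.
Proof. by case/setD1P. Qed.

Lemma part_sub A : A \in pi -> A \subset int.
Proof.
have /and3P[/eqP cov _ _] := pi_partition; rewrite /int -cov.
by move=> Api; apply: (bigcup_max A).
Qed.

Lemma part_pblock A f : A \in pi -> f \in A -> pblock pi f = A.
Proof. have /and3P[_ tI _] := pi_partition; exact: def_pblock. Qed.

Lemma pblock_part f : f \in int -> pblock pi f \in pi /\ f \in pblock pi f.
Proof.
have /and3P[/eqP cov _ _] := pi_partition.
by rewrite /int -cov => fc; rewrite pblock_mem // mem_pblock.
Qed.

(** Adjacency in the dual demands exactly one common edge. Having at most one in any case makes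
    every common edge a dual adjacency and lets it be identified from the two faces. *)
Lemma dual_adjP f g x : f \in int -> g \in int -> f != g ->
  x \in face_edges f :&: face_edges g ->
  dual f g /\ face_edges f :&: face_edges g = [set x].
Proof.
move=> fI gI fg xfg.
have le1 := face_edgesI_card simple_e rot_e conn2 euler outerF outer_cover fI gI fg.
have /cards1P[y ey] : #|face_edges f :&: face_edges g| == 1.
  by rewrite eqn_leq le1 (cardsD1 x) xfg.
split; last by move: xfg; rewrite ey inE => /eqP ->.
by apply/and4P; split=> //; rewrite ey cards1.
Qed.

Lemma dual_adj_sym : symmetric dual.
Proof.
move=> f g; rewrite /dual /dual_adj /= andbCA; congr [&& _, _ & _].
by rewrite eq_sym setIC.
Qed.

(** Inside a part, the parent of a face is its predecessor on a shortest walk from a face that owns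
    [ext A]; that face hangs from the exterior face across [ext A]. Heights are distances measured
    within each part. *)
Lemma part_forest : exists (pd : {set V * V} -> V * V) (h : {set V * V} -> nat)
    (root : {set {set V * V}} -> {set V * V}),
  (forall A, A \in pi -> root A \in A) /\
  forall f, f \in int -> let A := pblock pi f in let p := face (flip (pd f)) in
    pd f \in f /\ if f == root A then p = outer /\ edge_of (pd f) = ext A
                  else p \in A /\ h p < h f.
Proof.
have [V2 _ _] := conn2; have /card_gt0P[v0 _] : 0 < #|V| by case: #|V| V2.
have /fin_all_exists[root rootP] A : exists f, A \in pi ->
    (f \in A) && (ext A \in face_edges f :&: face_edges outer).
  have [/extP[f fA xf]|] := boolP (A \in pi); last by exists outer.
  by exists f; rewrite fA xf.
pose h f := gdist (induced (pblock pi f) dual) (root (pblock pi f)) f.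
suff /fin_all_exists[pd pdP] f : exists d, f \in int ->
    let A := pblock pi f in let p := face (flip d) in
    d \in f /\ if f == root A then p = outer /\ edge_of d = ext A
                  else p \in A /\ h p < h f.
  by exists pd, h, root; split=> [A /rootP/andP[]|].
have [fI|] := boolP (f \in int); last by exists (v0, v0).
have fF := int_faces_sub fI; have [Api fA] := pblock_part fI.
set A := pblock pi f in Api fA *.
have /andP[rA /setIP[xr xo]] := rootP _ Api.
have [ef|nf] := eqVneq f (root A).
  move: xr; rewrite -ef => /(face_edgesP simple_e rot_e _ fF)[d dD [ed ex]].
  exists d => _ /=; split; first by rewrite ed face_id.
  rewrite -/A -ef eqxx; split=> //.
  apply: (face_edges_flip simple_e rot_e) => //; last by rewrite -ex.
  apply/negP => /(facesP simple_e rot_e outerF)[_ eo].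
  by move: fI; rewrite ed -eo in_setD1 eqxx.
have [_ cA _] := pi_tree Api.
have := cA _ _ rA fA; rewrite eq_sym in nf => /gdist_parent/(_ nf)[z [+ _ lt]].
rewrite inducedE => /and3P[zA _ /and4P[zI _ zf /cards1P[x /setP/(_ x)]]].
rewrite !inE eqxx => /andP[xz xf].
have [d dD [ed ex]] := face_edgesP simple_e rot_e _ fF xf.
have ez : face (flip d) = z.
  apply: (face_edges_flip simple_e rot_e) => //; last by rewrite -ex.
    exact: int_faces_sub.
  apply/negP => /(facesP simple_e rot_e (int_faces_sub zI))[_ ez].
  by move: zf; rewrite ez ed eqxx.
exists d => _ /=; split; first by rewrite ed face_id.
rewrite -/A eq_sym (negPf nf) ez; split; first exact: zA.
by rewrite /h (part_pblock Api zA).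
Qed.

Lemma removed_edges_spanner t : 0 < t -> cost pi <= t - 1 ->
  tree_spanner e t (edges e :\: removed_edges).
Proof.
move=> t0 cost_t; have [pd [h [root [rootA pdA]]]] := part_forest.
pose par f := face (flip (pd f)).
have pdP f : f \in faces e rot :\: [set outer] ->
    pd f \in f /\ (par f \in [set outer] \/ h (par f) < h f).
  move=> fI; have [pf] := pdA f fI; case: ifP => _ [p1 p2]; split=> //.
    by left; rewrite inE; apply/eqP.
  by right.
have parA A f : A \in pi -> f \in A -> f != root A -> par f \in A /\ h (par f) < h f.
  move=> Api fA nf; have fI := subsetP (part_sub Api) _ fA.
  by have [_] := pdA f fI; rewrite (part_pblock Api fA) (negPf nf).
have pdE f : f \in int -> edge_of (pd f) \in face_edges f.
  by move=> /pdP[pf _]; apply: imset_f.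
have parE f : edge_of (pd f) \in face_edges (par f).
  by rewrite -edge_of_flip; apply: imset_f; apply: face_id.
have parN f : f \in int -> par f != f by move=> fI; apply: (par_neq pdP).
(* The removed edges are exactly the parent edges, so all facts on dual forests apply to them. *)
have eqD : removed_edges = tree_edges e rot [set outer] pd.
  apply/eqP; rewrite eqEsubset; apply/andP; split; apply/subsetP => x; last first.
    case/imsetP => f fI ->; have [Api fA] := pblock_part fI.
    apply/bigcupP; exists (pblock pi f) => //; rewrite !inE.
    have [ef|nf] := eqVneq f (root (pblock pi f)).
      by have [_] := pdA f fI; rewrite -ef eqxx => -[_ ->]; rewrite eqxx.
    have [pA _] := parA _ _ Api fA nf.
    apply/orP; right; apply/exists_inP; exists f => //; apply/exists_inP.
    by exists (par f) => //; rewrite eq_sym parN // inE pdE // parE.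
  case/bigcupP => A Api; rewrite in_setU1 => /predU1P[->|].
    have rA := rootA _ Api; have rI := subsetP (part_sub Api) _ rA.
    have [_] := pdA _ rI; rewrite (part_pblock Api rA) eqxx => -[_ <-].
    exact: imset_f.
  rewrite inE => /exists_inP[f fA] /exists_inP[g gA] /andP[fg xfg].
  have [fI gI] := (subsetP (part_sub Api) _ fA, subsetP (part_sub Api) _ gA).
  have [dfg efg] := dual_adjP fI gI fg xfg.
  (* [P] is the parent relation inside the part. It already connects [A], so acyclicity of the dual
     tree makes the adjacent faces [f] and [g] parent and child. *)
  pose P := [rel a b | [&& a \in A, b \in A & (par a == b) || (par b == a)]].
  have symP : symmetric P by move=> a b; rewrite /= andbCA orbC.
  have sP : subrel P (induced A dual).
    suff half a b : a \in A -> b \in A -> par a = b -> dual a b.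
      move=> a b /= /and3P[aA bA ab]; rewrite inducedE aA bA /=.
      by case/orP: ab => /eqP ab; [|rewrite dual_adj_sym]; apply: half.
    move=> aA bA ab; have [aI bI] := (subsetP (part_sub Api) _ aA, subsetP (part_sub Api) _ bA).
    have [] // := @dual_adjP a b (edge_of (pd a)) aI bI.
      by rewrite -ab eq_sym parN.
    by rewrite inE pdE // -ab parE.
  have cP a : a \in A -> connect P (root A) a.
    have [k] := ubnP (h a); elim: k a => // k IH a hk aA.
    have [->|na] := eqVneq a (root A); first exact: connect0.
    have [pA lt] := parA _ _ Api aA na.
    apply: (@connect_trans _ _ (par a)); first exact: IH (leq_trans lt hk) pA.
    by apply: connect1; rewrite /= pA aA eqxx orbT.
  have cfg : connect P f g.
    by apply: connect_trans (cP _ gA); rewrite sym_connect_sym ?cP.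
  have [_ _ acA] := pi_tree Api.
  have := acyclic_edge dual_adj_sym acA sP cfg; rewrite inducedE fA gA dfg => /(_ isT fg).
  case/and3P => _ _ /orP[]/eqP pfg; apply/imsetP.
    exists f => //; have : edge_of (pd f) \in face_edges f :&: face_edges g.
      by rewrite inE pdE // -pfg parE.
    by rewrite efg inE => /eqP ->.
  exists g => //; have : edge_of (pd g) \in face_edges f :&: face_edges g.
    by rewrite inE pdE // -pfg parE.
  by rewrite efg inE => /eqP ->.
have sO : [set outer] \subset faces e rot by rewrite sub1set.
have cF u v : connect (adj (edges e :\: removed_edges)) u v.
  have := @cotree_connected _ e rot simple_e rot_e [set outer] pd h pdP set0.
  rewrite setD0 -eqD; apply=> [d _|a b]; first by rewrite inE.
  by rewrite connect_edges // (two_connected_connect conn2).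
have cardD : #|removed_edges| + 1 = #|faces e rot|.
  by rewrite eqD -(card_tree_edges simple_e rot_e pdP sO) cards1.
have subD : removed_edges \subset edges e.
  by rewrite eqD; apply: (tree_edges_sub simple_e rot_e pdP).
have [V2 _ _] := conn2.
split; first exact: subsetDl.
  apply: tree_of_card => //; first by case: #|V| V2.
  rewrite cardsDS //; have leD := subset_leq_card subD.
  have arith (d f v m : nat) : d + 1 = f -> v + f = m + 2 -> d <= m -> 2 < v ->
    m - d < v by clear; lia.
  exact: arith cardD euler leD V2.
apply: spanner_of_edges => [x y|x y xy]; first exact: (two_connected_connect conn2).
have xyE : [set x; y] \in edges e.
  by rewrite -[[set x; y]]/(edge_of (x, y)) edges_dart // inE.
have [xyD|xyD] := boolP ([set x; y] \in removed_edges); last first.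
  by exists [:: y]; rewrite /= andbT adjE inE xyD xyE.
have := xyD; rewrite {1}eqD => /imsetP[f fI exy]; have [Api fA] := pblock_part fI.
set A := pblock pi f in Api fA *.
have sA := part_sub Api.
(* A face with its parent in [A] is not the root of its own part, since roots hang from the exterior
   face. So its parent lies in its own part, which must be [A]. *)
have clA g : g \in faces e rot :\: [set outer] -> par g \in A -> g \in A.
  move=> gI pgA; have [Bpi gB] := pblock_part gI.
  have [eg|ng] := eqVneq g (root (pblock pi g)).
    have [_] := pdA g gI; rewrite -eg eqxx => -[po _].
    by move: (subsetP sA _ pgA); rewrite in_setD1 [par g]po eqxx.
  have [pgB _] := parA _ _ Bpi gB ng.
  by rewrite -(part_pblock Api pgA) (part_pblock Bpi pgB).
have := tree_edge_bypass simple_e rot_e pdP sA clA fA.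
rewrite -eqD; set EA := \bigcup_(g in A) face_edges g :\: removed_edges.
move=> byp; have {byp} /connect_adj_path[p [pp lp szp]] : connect (adj EA) x y.
  have [ea|ea] := @edge_of_eq _ (pd f) (x, y) (esym exy).
    by move: byp; rewrite -ea connect_adjC.
  by case: ea => -> ->.
exists p; split=> //.
  apply: sub_path pp => a b; rewrite !adjE; apply: subsetP; apply: setSD.
  apply/bigcupsP => g gA; apply: (face_edges_sub simple_e rot_e).
  exact/int_faces_sub/(subsetP sA).
apply: leq_trans szp _.
have EAle : #|EA| <= \sum_(g in A) #|face_edges g :\: removed_edges|.
  apply: leq_trans (card_bigcup_le _ _); apply/subset_leq_card/subsetP => z.
  by case/setDP => /bigcupP[g gA zg] zD; apply/bigcupP; exists g; rewrite // inE zD.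
have rA := rootA _ Api.
(* A parent edge lies on its own face and, unless that face is the root, also on the parent, which
   is again in [A]. This gives at least [2 * #|A| - 1] incidences of removed edges with faces of
   [A]. *)
have incid k : k \in A -> (k != root A).+1 <= \sum_(g in A) (edge_of (pd k) \in face_edges g).
  move=> kA; have kI := subsetP sA _ kA; rewrite (big_setD1 k) //= pdE //.
  have [//|nk] := eqVneq k (root A); have [pA _] := parA _ _ Api kA nk.
  by rewrite (big_setD1 (par k)) ?inE ?parN //= parE.
have incid_sum : #|A|.*2 <= (\sum_(g in A) #|face_edges g :&: removed_edges|).+1.
  apply: (@leq_trans (\sum_(g in A) \sum_(k in A) (edge_of (pd k) \in face_edges g)).+1).
    rewrite exchange_big /= (big_setD1 (root A)) //= [#|A|](cardsD1 (root A)) rA.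
    rewrite add1n doubleS ltnS -add1n; apply: leq_add.
      by have := incid _ rA; rewrite eqxx.
    rewrite -muln2 -sum_nat_const; apply: leq_sum => k /setD1P[nk kA].
    by have := incid _ kA; rewrite nk.
  apply: leq_sum => g gA; rewrite -card_sep_sum.
  have inj : {in [set k in A | edge_of (pd k) \in face_edges g] &,
      injective (fun k => edge_of (pd k))}.
    move=> k l; rewrite ![_ \in finset _]inE => /andP[kA _] /andP[lA _].
    by apply: (tree_edge_inj simple_e rot_e pdP); apply: (subsetP sA).
  rewrite -(card_in_imset inj); apply/subset_leq_card/subsetP => _ /imsetP[k + ->].
  rewrite [_ \in finset _]inE => /andP[kA kg]; rewrite in_setI kg eqD /=.
  by apply: imset_f; apply: (subsetP sA).
(* Truncation in [weight] does no harm: [#|face_edges g| <= weight g + 2] holds in every case. *)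
have split_sum : \sum_(g in A) #|face_edges g :\: removed_edges| +
    \sum_(g in A) #|face_edges g :&: removed_edges| <= \sum_(g in A) weight g + #|A|.*2.
  rewrite -muln2 -sum_nat_const -!big_split /=; apply: leq_sum => g _.
  by rewrite addnC cardsID /weight; case: #|_| => [|[|k]]; rewrite ?addn2 ?subn2.
have wA : \sum_(g in A) weight g <= t - 1.
  by apply: leq_trans cost_t; apply: (bigmax_sup A).
(* The terms [2 * #|A|] cancel and leave [(t - 1) + 1], which equals [t] because [t] is positive. *)
have arith (ea s1 s2 w a : nat) : 0 < t -> ea <= s1 -> a.*2 <= s2.+1 -> s1 + s2 <= w + a.*2 ->
  w <= t - 1 -> ea <= t by clear; lia.
exact: arith t0 EAle incid_sum split_sum wA.
Qed.

End Spanner.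

(** * The program *)

Definition runs (B : nat) (c : com) (s : state) (K : nat) (Q : state -> Prop) : Prop :=
  exists k s', [/\ exec B c s k s', k <= K & Q s'].

Section Runs.
Variable B : nat.
Implicit Types (c : com) (R M : nat -> nat) (ws os : seq nat) (Q : state -> Prop).

Lemma runs_skip s K Q : Q s -> runs B Skip s K.+1 Q.
Proof. by move=> Qs; exists 1, s; split=> //; apply: exec_skip. Qed.

Lemma runs_seq K1 K2 c1 c2 s K Q :
  runs B c1 s K1 (fun s' => runs B c2 s' K2 Q) -> K1 + K2 <= K ->
  runs B (Seq c1 c2) s K Q.
Proof.
case=> k1 [s1 [e1 le1 [k2 [s2 [e2 le2 Qs]]]]] le.
exists (k1 + k2), s2; split=> //; first exact: exec_seq e1 e2.
by apply: leq_trans le; apply: leq_add.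
Qed.

Lemma runs_le K1 Q1 c s K Q : runs B c s K1 Q1 -> K1 <= K ->
  (forall s', Q1 s' -> Q s') -> runs B c s K Q.
Proof.
case=> k [s' [e le Qs]] leK h; exists k, s'; split=> //; last exact: h.
exact: leq_trans leK.
Qed.

Lemma runs_if x c1 c2 s K Q :
  (reg s x != 0 -> runs B c1 s K Q) -> (reg s x = 0 -> runs B c2 s K Q) ->
  runs B (If x c1 c2) s K.+1 Q.
Proof.
move=> h1 h2; have [x0|x0] := eqVneq (reg s x) 0.
  have [k [s' [e le Qs]]] := h2 x0; exists k.+1, s'; split=> //.
  exact: exec_if_false.
have [k [s' [e le Qs]]] := h1 x0; exists k.+1, s'; split=> //.
exact: exec_if_true.
Qed.

(** The list of entries still to be processed, not the counter, drives the induction, so the running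
    time comes out as a sum over entries. Each [.+1] pays for one evaluation of the loop test. *)
Lemma runs_for (X : Type) x c (I : seq X -> seq X -> state -> Prop) (K : X -> nat) :
  (forall done a rest s, I done (a :: rest) s ->
     reg s x != 0 /\ runs B c s (K a) (I (rcons done a) rest)) ->
  (forall done s, I done [::] s -> reg s x = 0) ->
  forall rest done s, I done rest s ->
  runs B (While x c) s (sumn [seq (K a).+1 | a <- rest]).+1 (I (done ++ rest) [::]).
Proof.
move=> hS h0; elim=> [|a rest IH] done s Is.
  by exists 1, s; split; [apply: exec_while_false; apply: h0 Is| |rewrite cats0].
have [x0 [k1 [s1 [e1 le1 /IH[k2 [s2 [e2 le2 Is2]]]]]]] := hS _ _ _ _ Is.
exists (k1 + k2).+1, s2; split; first exact: exec_while_true e1 e2.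
  by rewrite /= ltnS addSn -addnS leq_add.
by rewrite -cat_rcons.
Qed.

Lemma fits_reg R M ws os ws' os' x v : fits B (State R M ws os) -> v <= B ->
  fits B (State (upd R x v) M ws' os').
Proof. by move=> ft vB i; have [h1 h2] := ft i; split=> //=; rewrite /upd; case: ifP. Qed.

Lemma fits_mem R M ws os a v : fits B (State R M ws os) -> v <= B ->
  fits B (State R (upd M a v) ws os).
Proof. by move=> ft vB i; have [h1 h2] := ft i; split=> //=; rewrite /upd; case: ifP. Qed.

Lemma runs_do i c s s1 K Q : do_instr i s = Some s1 -> fits B s1 ->
  runs B c s1 K Q -> runs B (Seq (Do i) c) s K.+1 Q.
Proof.
move=> e1 f1 [k [s' [e2 le Qs]]]; exists k.+1, s'; split=> //.
by rewrite -add1n; apply: exec_seq e2; apply: exec_do.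
Qed.

Variables (R M : nat -> nat) (ws os : seq nat) (c : com) (K : nat) (Q : state -> Prop).
Hypothesis ft : fits B (State R M ws os).

Lemma runs_const x v : v <= B ->
  (fits B (State (upd R x v) M ws os) -> runs B c (State (upd R x v) M ws os) K Q) ->
  runs B (Seq (Do (Const x v)) c) (State R M ws os) K.+1 Q.
Proof. by move=> vB h; have ft' := fits_reg ws os x ft vB; apply: runs_do (h ft'). Qed.

Lemma runs_add x y z v : R y + R z = v -> v <= B ->
  (fits B (State (upd R x v) M ws os) -> runs B c (State (upd R x v) M ws os) K Q) ->
  runs B (Seq (Do (Add x y z)) c) (State R M ws os) K.+1 Q.
Proof.
by move=> <- vB h; have ft' := fits_reg ws os x ft vB; apply: runs_do (h ft').
Qed.

(** No word bound has to be supplied here: a truncated difference cannot exceed a word already held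
    in a register. *)
Lemma runs_sub x y z v : R y - R z = v ->
  (fits B (State (upd R x v) M ws os) -> runs B c (State (upd R x v) M ws os) K Q) ->
  runs B (Seq (Do (Defs.Sub x y z)) c) (State R M ws os) K.+1 Q.
Proof.
move=> <- h; have vB : R y - R z <= B.
  by have [/= h1 _] := ft y; apply: leq_trans h1; apply: leq_subr.
by have ft' := fits_reg ws os x ft vB; apply: runs_do (h ft').
Qed.

Lemma runs_fetch x y v : M (R y) = v ->
  (fits B (State (upd R x v) M ws os) -> runs B c (State (upd R x v) M ws os) K Q) ->
  runs B (Seq (Do (Fetch x y)) c) (State R M ws os) K.+1 Q.
Proof.
move=> <- h; have vB : M (R y) <= B by have [/= _ h1] := ft (R y).
by have ft' := fits_reg ws os x ft vB; apply: runs_do (h ft').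
Qed.

Lemma runs_store x y a v : R x = a -> R y = v ->
  (fits B (State R (upd M a v) ws os) -> runs B c (State R (upd M a v) ws os) K Q) ->
  runs B (Seq (Do (Store x y)) c) (State R M ws os) K.+1 Q.
Proof.
move=> <- <- h; have vB : R y <= B by have [/= h1 _] := ft y.
by have ft' := fits_mem (R x) ft vB; apply: runs_do (h ft').
Qed.

Lemma runs_write x v : R x = v ->
  (fits B (State R M ws (rcons os v)) -> runs B c (State R M ws (rcons os v)) K Q) ->
  runs B (Seq (Do (Write x)) c) (State R M ws os) K.+1 Q.
Proof. by move=> <- h; apply: runs_do (h _). Qed.

End Runs.

Lemma runs_read B R M w ws os c K Q x : fits B (State R M (w :: ws) os) -> w <= B ->
  (fits B (State (upd R x w) M ws os) -> runs B c (State (upd R x w) M ws os) K Q) ->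
  runs B (Seq (Do (Read x)) c) (State R M (w :: ws) os) K.+1 Q.
Proof. by move=> ft wB h; have ft' := fits_reg ws os x ft wB; apply: runs_do (h ft'). Qed.

(** * The instructions of the algorithm *)

Definition block (cs : seq com) : com := foldr Seq Skip cs.

(* Memory cells [4 i] and [4 i + 1] hold the endpoints of edge [i], [4 i + 2]
   its label, and [4 p + 3] records whether part [p] has lost an external edge.
   Registers 0 to 4 hold the constants 0 to 4. *)
Definition layout (M U V L K : nat -> nat) : Prop :=
  forall i, [/\ M (4 * i) = U i, M (4 * i + 1) = V i, M (4 * i + 2) = L i
              & M (4 * i + 3) = K i].

Definition consts (R : nat -> nat) : Prop :=
  [/\ R 0 = 0, R 1 = 1, R 2 = 2, R 3 = 3 & R 4 = 4].

Definition set_consts : com := block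
  [:: Do (Const 1 1); Do (Const 2 2); Do (Const 3 3); Do (Const 4 4)].

(** Register 5 holds the number of edges, 6 counts the edges left in a loop over them, and 7 is a
    memory address. Registers 9, 11 and 12 count the parts, faces and edge indices still to be read,
    and 10 is the number of the current part. Registers 8 and 13 to 15 are scratch. *)
Definition read_edge : com := block
  [:: Do (Read 8); Do (Store 7 8); Do (Add 7 7 1); Do (Read 8); Do (Store 7 8);
      Do (Add 7 7 3); Do (Defs.Sub 6 6 1)].

(** Equality of the label with the part number is tested by adding the two truncated differences,
    whose sum vanishes just when the numbers agree. *)
Definition read_index : com := block
  [:: Do (Read 8); Do (Add 8 8 8); Do (Add 8 8 8); Do (Add 8 8 2); Do (Fetch 13 8);
      If 13 (block [:: Do (Defs.Sub 14 10 13); Do (Defs.Sub 15 13 10); Do (Add 14 14 15);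
                       If 14 (block [:: Do (Store 8 0)]) (block [:: Do (Store 8 1)])])
            (block [:: Do (Store 8 10)]);
      Do (Defs.Sub 12 12 1)].

Definition read_face : com := block
  [:: Do (Read 12); While 12 read_index; Do (Defs.Sub 11 11 1)].

Definition read_part : com := block
  [:: Do (Add 10 10 1); Do (Read 11); While 11 read_face; Do (Defs.Sub 9 9 1)].

(** Register 14 receives the decision to write. For a label above 1 it is the previous mark of that
    part, and the mark is set at the same time, so only the first edge with this label is
    dropped. *)
Definition write_edge : com := block
  [:: Do (Fetch 13 7);
      If 13 (block [:: Do (Defs.Sub 14 13 1);
                       If 14 (block [:: Do (Add 8 13 13); Do (Add 8 8 8); Do (Add 8 8 3);
                                        Do (Fetch 14 8); Do (Store 8 1)]) Skip])
            (block [:: Do (Const 14 1)]);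
      If 14 (block [:: Do (Defs.Sub 8 7 2); Do (Fetch 15 8); Do (Write 15);
                       Do (Add 8 8 1); Do (Fetch 15 8); Do (Write 15)]) Skip;
      Do (Add 7 7 4); Do (Defs.Sub 6 6 1)].

(** The number of vertices is read and overwritten. Register 10 starts at 1 and is raised before
    each part, so parts are numbered from 2 and the labels 0 and 1 stay free for inner edges.
    Address 2 is the label cell of the first edge. *)
Definition spanner_program : com := block
  [:: set_consts; Do (Read 5); Do (Read 5); Do (Add 6 5 0); While 6 read_edge;
      Do (Read 9); Do (Const 10 1); While 9 read_part;
      Do (Add 6 5 0); Do (Const 7 2); While 6 write_edge].

(** * Functional specification of labels, input and output *)

Definition edge_words (d : nat * nat) : seq nat := [:: d.1; d.2].

(* The label of an edge after a further occurrence in a face of part [p >= 2]: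
   [0] before the first occurrence, then the number of the part of that
   occurrence, and finally [1] if the two parts agree and [0] otherwise. *)
Definition relabel (v p : nat) : nat :=
  if v == 0 then p else if v == p then 1 else 0.

Definition label (occ : seq (nat * nat)) (i : nat) : nat :=
  foldl relabel 0 [seq o.1 | o <- occ & o.2 == i].

Fixpoint part_occs (p : nat) (pss : seq (seq (seq nat))) : seq (nat * nat) :=
  if pss is fs :: pss' then [seq (p, i) | i <- flatten fs] ++ part_occs p.+1 pss'
  else [::].

(** In the end label 0 stands for an inner edge between two parts, 1 for an inner edge of one part,
    and a larger label for an external edge of the part with that number. *)
Definition kept (L : nat -> nat) (i : nat) : bool :=
  (L i == 0) || (L i != 1) && has (fun j => L j == L i) (iota 0 i).

Definition list_words (f : seq nat) : seq nat := size f :: f.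

Definition part_words (fs : seq (seq nat)) : seq nat :=
  size fs :: flatten [seq list_words f | f <- fs].

Lemma label_rcons occ p i :
  label (rcons occ (p, i)) =1 upd (label occ) i (relabel (label occ i) p).
Proof.
move=> j; rewrite /label /upd filter_rcons /= [i == j]eq_sym; case: eqP => // ->.
by rewrite map_rcons -cats1 foldl_cat.
Qed.

Lemma part_occs_rcons p pss fs : part_occs p (rcons pss fs) =
  part_occs p pss ++ [seq (p + size pss, i) | i <- flatten fs].
Proof.
elim: pss p => [|gs pss IH] p /=; first by rewrite addn0 cats0.
by rewrite IH catA addnS addSn.
Qed.

Lemma sumn_map_const (T : Type) c (l : seq T) : sumn [seq c | _ <- l] = size l * c.
Proof. by elim: l => //= _ l ->; rewrite mulSn. Qed.

Ltac look := rewrite /upd /=; lia.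

(** * Correctness and cost of the program *)

Section Program.
Variables (B : nat) (es : seq (nat * nat)).
Let m := size es.
Hypothesis mB : 4 * m + 4 <= B.
Let U i := (nth (0, 0) es i).1.
Let V i := (nth (0, 0) es i).2.

Lemma layout_U M U' V' L K a i u : layout M U' V' L K -> a = 4 * i ->
  layout (upd M a u) (upd U' i u) V' L K.
Proof.
move=> lay -> j; have [h1 h2 h3 h4] := lay j; split; rewrite /upd.
- by have [->|ne] := eqVneq j i; [rewrite eqxx | case: eqP => //; lia].
- by case: eqP => //; lia.
- by case: eqP => //; lia.
- by case: eqP => //; lia.
Qed.

Lemma layout_V M U' V' L K a i u : layout M U' V' L K -> a = 4 * i + 1 ->
  layout (upd M a u) U' (upd V' i u) L K.
Proof.
move=> lay -> j; have [h1 h2 h3 h4] := lay j; split; rewrite /upd.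
- by case: eqP => //; lia.
- by have [->|ne] := eqVneq j i; [rewrite eqxx | case: eqP => //; lia].
- by case: eqP => //; lia.
- by case: eqP => //; lia.
Qed.

Lemma layout_L M U' V' L K a i u : layout M U' V' L K -> a = 4 * i + 2 ->
  layout (upd M a u) U' V' (upd L i u) K.
Proof.
move=> lay -> j; have [h1 h2 h3 h4] := lay j; split; rewrite /upd.
- by case: eqP => //; lia.
- by case: eqP => //; lia.
- by have [->|ne] := eqVneq j i; [rewrite eqxx | case: eqP => //; lia].
- by case: eqP => //; lia.
Qed.

Lemma layout_K M U' V' L K a i u : layout M U' V' L K -> a = 4 * i + 3 ->
  layout (upd M a u) U' V' L (upd K i u).
Proof.
move=> lay -> j; have [h1 h2 h3 h4] := lay j; split; rewrite /upd.
- by case: eqP => //; lia.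
- by case: eqP => //; lia.
- by case: eqP => //; lia.
- by have [->|ne] := eqVneq j i; [rewrite eqxx | case: eqP => //; lia].
Qed.

Lemma layout_eq M U1 V1 L1 K1 U2 V2 L2 K2 : layout M U1 V1 L1 K1 ->
  U1 =1 U2 -> V1 =1 V2 -> L1 =1 L2 -> K1 =1 K2 -> layout M U2 V2 L2 K2.
Proof. by move=> lay h1 h2 h3 h4 i; have [] := lay i; rewrite h1 h2 h3 h4. Qed.

Definition read_inv (tail : seq nat) (done rest : seq (nat * nat)) (s : state) : Prop :=
  exists R M, [/\ s = State R M (flatten [seq edge_words d | d <- rest] ++ tail) [::],
    fits B s, consts R /\ done ++ rest = es,
    [/\ R 5 = m, R 6 = size rest, R 7 = 4 * size done, R 11 = 0 & R 12 = 0]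
    & layout M (fun i => (nth (0, 0) done i).1) (fun i => (nth (0, 0) done i).2)
        (fun=> 0) (fun=> 0)].

Lemma read_edgesP tail s : all (fun d => (d.1 <= B) && (d.2 <= B)) es ->
  read_inv tail [::] es s ->
  runs B (While 6 read_edge) s (m * 9).+1 (read_inv tail es [::]).
Proof.
move=> esB inv0.
have := @runs_for B _ 6 read_edge (read_inv tail) (fun=> 8) _ _ es [::] s inv0.
rewrite sumn_map_const.
apply.
  move=> dn [u v] rest _ [R [M [-> ft [cs edr] [r5 r6 r7 r11 r12] lay]]].
  have [r0 r1 r2 r3 r4] := cs; rewrite /= in r6; split; first by rewrite /= r6.
  have /andP[uB vB] : (u <= B) && (v <= B).
    by apply: (allP esB (u, v)); rewrite -edr mem_cat mem_head orbT.
  have szd : size dn < m by rewrite /m -edr size_cat /=; lia.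
  apply: (runs_read ft) => // {}ft /=.
  apply: (@runs_store _ _ _ _ _ _ _ _ ft _ _ (4 * size dn) u); [look..|move=> {}ft].
  apply: (@runs_add _ _ _ _ _ _ _ _ ft _ _ _ (4 * size dn + 1)); [look|lia|move=> {}ft].
  apply: (runs_read ft) => // {}ft /=.
  apply: (@runs_store _ _ _ _ _ _ _ _ ft _ _ (4 * size dn + 1) v); [look..|move=> {}ft].
  apply: (@runs_add _ _ _ _ _ _ _ _ ft _ _ _ (4 * (size dn).+1)); [look|lia|move=> {}ft].
  apply: (@runs_sub _ _ _ _ _ _ _ _ ft _ _ _ (size rest)); [look|move=> {}ft].
  apply: runs_skip; eexists; eexists; split; [by []|by []| | |].
  - by split; [split; rewrite /upd|rewrite cat_rcons].
  - by split; rewrite /upd //= size_rcons.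
  apply: (layout_eq (layout_V (i := size dn) v (layout_U (i := size dn) u lay _) _)) => // i.
  - by rewrite /upd /= nth_rcons; case: ltngtP => // h; rewrite nth_default //; lia.
  - by rewrite /upd /= nth_rcons; case: ltngtP => // h; rewrite nth_default //; lia.
by move=> dn _ [R [M [-> _ _ [_ /= -> _ _ _] _]]].
Qed.

Definition scan_inv occ r9 r10 r11 r12 ws (s : state) : Prop :=
  exists R M, [/\ s = State R M ws [::], fits B s, consts R,
    [/\ R 5 = m, R 9 = r9, R 10 = r10, R 11 = r11 & R 12 = r12]
    & layout M U V (label occ) (fun=> 0)].

Lemma read_indexP occ r9 p r11 k i ws s : scan_inv occ r9 p r11 k.+1 (i :: ws) s ->
  0 < p -> 4 * i + 2 <= B ->
  runs B read_index s 17 (scan_inv (rcons occ (p, i)) r9 p r11 k ws).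
Proof.
case=> R [M [-> ft cs [r5 e9 e10 e11 e12] lay]] p0 iB.
have [r0 r1 r2 r3 r4] := cs; have [_ _ layL _] := lay i.
have pB : p <= B by have [/=] := ft 10; rewrite e10.
apply: (runs_read ft) => [|{}ft]; first by lia.
apply: (@runs_add _ _ _ _ _ _ _ _ ft _ _ _ (2 * i)); [look|lia|move=> {}ft].
apply: (@runs_add _ _ _ _ _ _ _ _ ft _ _ _ (4 * i)); [look|lia|move=> {}ft].
apply: (@runs_add _ _ _ _ _ _ _ _ ft _ _ _ (4 * i + 2)); [look|lia|move=> {}ft].
apply: (@runs_fetch _ _ _ _ _ _ _ _ ft _ _ (label occ i)); [by rewrite /upd /= layL|move=> {}ft].
apply: (@runs_seq _ 9 3) => //.
pose Q1 s' := exists R' M', [/\ s' = State R' M' ws [::], fits B s', consts R',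
    [/\ R' 5 = m, R' 9 = r9, R' 10 = p, R' 11 = r11 & R' 12 = k.+1]
    & layout M' U V (label (rcons occ (p, i))) (fun=> 0)].
apply: (@runs_le _ 9 Q1) => //; last first.
  move=> _ [R' [M' [-> {}ft cs' [r5' e9' e10' e11' e12'] lay']]].
  have [_ r1' _ _ _] := cs'.
  apply: (@runs_sub _ _ _ _ _ _ _ _ ft _ _ _ k); [look|move=> {}ft].
  by apply: runs_skip; exists (upd R' 12 k), M'; split.
apply: runs_if => /=; rewrite /upd /= => li; last first.
  apply: (@runs_store _ _ _ _ _ _ _ _ ft _ _ (4 * i + 2) p); [look..|move=> {}ft].
  apply: runs_skip; eexists; eexists; split; [by []|by []|by []|by []|].
  apply: (layout_eq (layout_L (i := i) p lay _)) => // j.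
  by rewrite label_rcons /relabel li.
apply: (@runs_sub _ _ _ _ _ _ _ _ ft _ _ _ (p - label occ i)); [look|move=> {}ft].
apply: (@runs_sub _ _ _ _ _ _ _ _ ft _ _ _ (label occ i - p)); [look|move=> {}ft].
apply: (@runs_add _ _ _ _ _ _ _ _ ft _ _ _ ((p - label occ i) + (label occ i - p))).
- look.
- have [/= h1 _] := ft 14; have [/= h2 _] := ft 15; move: h1 h2; look.
move=> {}ft; apply: (@runs_seq _ 3 1) => //.
apply: runs_if => /=; rewrite /upd /= => ne.
  apply: (@runs_store _ _ _ _ _ _ _ _ ft _ _ (4 * i + 2) 0); [look..|move=> {}ft].
  apply: runs_skip; apply: runs_skip; eexists; eexists; split; [by []|by []|by []|by []|].
  apply: (layout_eq (layout_L (i := i) 0 lay _)) => // j.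
  by rewrite label_rcons /relabel (negPf li); case: eqP => // eq; move: ne; rewrite eq subnn.
apply: (@runs_store _ _ _ _ _ _ _ _ ft _ _ (4 * i + 2) 1); [look..|move=> {}ft].
apply: runs_skip; apply: runs_skip; eexists; eexists; split; [by []|by []|by []|by []|].
apply: (layout_eq (layout_L (i := i) 1 lay _)) => // j.
by rewrite label_rcons /relabel (negPf li); case: eqP => // ; lia.
Qed.

Lemma read_faceP occ r9 p r11 f ws s : scan_inv occ r9 p r11.+1 0 (list_words f ++ ws) s ->
  0 < p -> size f <= B -> all (fun i => 4 * i + 2 <= B) f ->
  runs B read_face s (size f * 18 + 4)
    (scan_inv (occ ++ [seq (p, i) | i <- f]) r9 p r11 0 ws).
Proof.
case=> R [M [-> ft cs [r5 e9 e10 e11 e12] lay]] p0 fB iB.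
have -> : size f * 18 + 4 = (size f * 18 + 3).+1 by rewrite addnS.
apply: (runs_read ft) => // {}ft.
apply: (@runs_seq _ (size f * 18).+1 2); last by rewrite addn2 addn3.
pose inv dn rest := scan_inv (occ ++ [seq (p, i) | i <- dn]) r9 p r11.+1 (size rest) (rest ++ ws).
have inv0 : inv [::] f (State (upd R 12 (size f)) M (f ++ ws) [::]).
  by exists (upd R 12 (size f)), M; rewrite cats0.
have loop : runs B (While 12 read_index) (State (upd R 12 (size f)) M (f ++ ws) [::])
    (size f * 18).+1 (fun s => inv f [::] s /\ true).
  rewrite -sumn_map_const.
  (* The loop rule does not record that the current entry comes from [f], so the address bounds of
     the unread indices travel with the invariant. *)
  pose inv' dn rest s := inv dn rest s /\ all (fun i => 4 * i + 2 <= B) rest.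
  apply: (@runs_for _ _ 12 read_index inv' (fun=> 17) _ _ f [::]) => //.
    move=> dn i rest s' [h /andP[iB' aB]]; split; last first.
      apply: (runs_le (read_indexP h p0 iB')) => // s1.
      by rewrite rcons_cat => h1; split=> //; rewrite /inv map_rcons.
    by case: h => R' [M' [-> _ _ [_ _ _ _ /= ->] _]].
  by move=> dn s' [[R' [M' [-> _ _ [_ _ _ _ /= ->] _]]] _].
apply: (runs_le loop) => // _ [[R' [M' [-> {}ft cs' [r5' e9' e10' e11' e12'] lay']]] _].
have [_ r1' _ _ _] := cs'.
apply: (@runs_sub _ _ _ _ _ _ _ _ ft _ _ _ r11); [look|move=> {}ft].
by apply: runs_skip; exists (upd R' 11 r11), M'; split.
Qed.

Definition part_cost (fs : seq (seq nat)) : nat :=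
  sumn [seq size f * 18 + 5 | f <- fs] + 5.

Lemma read_partP occ r9 p fs ws s : scan_inv occ r9.+1 p 0 0 (part_words fs ++ ws) s ->
  p < B -> size fs <= B ->
  all (fun f => (size f <= B) && all (fun i => 4 * i + 2 <= B) f) fs ->
  runs B read_part s (part_cost fs)
    (scan_inv (occ ++ [seq (p.+1, i) | i <- flatten fs]) r9 p.+1 0 0 ws).
Proof.
case=> R [M [-> ft cs [r5 e9 e10 e11 e12] lay]] pB szB fsB.
have [_ r1 _ _ _] := cs.
rewrite /part_cost !addnS addn0.
apply: (@runs_add _ _ _ _ _ _ _ _ ft _ _ _ p.+1); [look|lia|move=> {}ft].
apply: (runs_read ft) => // {}ft.
set S := sumn _.
apply: (@runs_seq _ S.+1 2); last by rewrite addn2.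
pose inv dn rest s := scan_inv (occ ++ [seq (p.+1, i) | i <- flatten dn]) r9.+1 p.+1 (size rest) 0
   (flatten [seq list_words f | f <- rest] ++ ws) s /\
   all (fun f => (size f <= B) && all (fun i => 4 * i + 2 <= B) f) rest.
set R1 := upd (upd R _ _) _ _.
have inv0 : inv [::] fs (State R1 M (flatten [seq list_words f | f <- fs] ++ ws) [::]).
  by split=> //; exists R1, M; rewrite cats0.
have loop : runs B (While 11 read_face)
    (State R1 M (flatten [seq list_words f | f <- fs] ++ ws) [::]) S.+1 (inv fs [::]).
  have -> : S = sumn [seq (size f * 18 + 4).+1 | f <- fs].
    by congr sumn; apply: eq_map => f; rewrite addnS.
  apply: (@runs_for _ _ 11 read_face inv (fun f => size f * 18 + 4) _ _ fs [::]) => //.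
    move=> dn f rest s' [h /andP[/andP[fB iB] aB]]; split.
      by case: h => R' [M' [-> _ _ [_ _ _ /= -> _] _]].
    rewrite /= -catA in h; apply: (runs_le (read_faceP h _ fB iB)) => // s1 h1; split=> //.
    by rewrite flatten_rcons map_cat catA.
  by move=> dn s' [[R' [M' [-> _ _ [_ _ _ /= -> _] _]]] _].
apply: (runs_le loop) => // _ [[R' [M' [-> {}ft cs' [r5' e9' e10' e11' e12'] lay']]] _].
have [_ r1' _ _ _] := cs'.
apply: (@runs_sub _ _ _ _ _ _ _ _ ft _ _ _ r9); [look|move=> {}ft].
by apply: runs_skip; exists (upd R' 9 r9), M'; split.
Qed.

Lemma read_partsP pss ws s : (size pss).+1 <= B ->
  all (fun fs => (size fs <= B) &&
    all (fun f => (size f <= B) && all (fun i => 4 * i + 2 <= B) f) fs) pss ->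
  scan_inv [::] (size pss) 1 0 0 (flatten [seq part_words fs | fs <- pss] ++ ws) s ->
  runs B (While 9 read_part) s (sumn [seq (part_cost fs).+1 | fs <- pss]).+1
    (scan_inv (part_occs 2 pss) 0 (size pss).+1 0 0 ws).
Proof.
move=> szB pB inv0.
pose inv dn rest s := scan_inv (part_occs 2 dn) (size rest) (size dn).+1 0 0
   (flatten [seq part_words f | f <- rest] ++ ws) s /\ dn ++ rest = pss.
have := @runs_for B _ 9 read_part inv part_cost _ _ pss [::] s (conj inv0 erefl).
move=> loop; apply: (runs_le (loop _ _)) => // {loop}.
- move=> dn fs rest s' [h eq]; split; last first.
    rewrite /= -catA in h.
    have /andP[fB iB] : (size fs <= B) &&
        all (fun f => (size f <= B) && all (fun i => 4 * i + 2 <= B) f) fs.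
      by apply: (allP pB); rewrite -eq mem_cat mem_head orbT.
    have dB : (size dn).+1 < B.
      by apply: leq_trans szB; rewrite -eq size_cat /= addnS !ltnS leq_addr.
    apply: (runs_le (read_partP h dB fB iB)) => // s1 h1; split; last by rewrite cat_rcons.
    by rewrite part_occs_rcons size_rcons.
  by case: h => R' [M' [-> _ _ [_ /= -> _ _ _] _]].
- by move=> dn s' [[R' [M' [-> _ _ [_ /= -> _ _ _] _]]] _].
by move=> s' [].
Qed.

Section WriteEdges.
Variables (L : nat -> nat) (ws : seq nat).
Hypothesis LB : forall i, 4 * L i + 3 <= B.

Definition kept_words (ks : seq nat) : seq nat :=
  flatten [seq edge_words (nth (0, 0) es i) | i <- ks & kept L i].

(** Only part numbers, which start at 2, are tracked; edges labelled 0 or 1 leave the marks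
    alone. *)
Definition used_parts (dn : seq nat) (K : nat -> nat) : Prop :=
  forall v, 1 < v -> K v = has (fun j => L j == v) dn.

Definition write_inv (dn rest : seq nat) (s : state) : Prop :=
  exists R M K, [/\ s = State R M ws (kept_words dn), fits B s,
    consts R /\ dn ++ rest = iota 0 m,
    R 6 = size rest /\ R 7 = 4 * size dn + 2
    & layout M U V L K /\ used_parts dn K].

Lemma write_edgeP dn i rest s : write_inv dn (i :: rest) s ->
  runs B write_edge s 24 (write_inv (rcons dn i) rest).
Proof.
case=> R [M [K [-> ft [cs edr] [r6 r7] [lay usd]]]].
have szm : size dn + (size rest).+1 = m by have := congr1 size edr; rewrite size_cat size_iota.
have ei : i = size dn.
  have := congr1 (fun l => nth 0 l (size dn)) edr; rewrite nth_cat ltnn subnn /= => ->.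
  by rewrite nth_iota //; lia.
(* Since the edges treated so far are [iota 0 i], the mark of a part answers exactly the search for
   an earlier equal label in [kept]. *)
have edn : dn = iota 0 i.
  have := congr1 (take (size dn)) edr; rewrite take_size_cat // => ->.
  by rewrite take_iota ei; congr iota; lia.
have [r0 r1 r2 r3 r4] := cs; rewrite /= in r6; rewrite -ei in r7.
have [layU layV layL _] := lay i; have [_ _ _ layK] := lay (L i).
have LiB := LB i.
apply: (@runs_fetch _ _ _ _ _ _ _ _ ft _ _ (L i)); [by rewrite /upd /= r7|move=> {}ft].
pose Q1 s' := exists R' M' K', [/\ s' = State R' M' ws (kept_words dn), fits B s', consts R',
    [/\ R' 6 = (size rest).+1, R' 7 = 4 * i + 2 & R' 14 = kept L i]
    & layout M' U V L K' /\ used_parts (rcons dn i) K'].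
have usd' v : v < 2 -> L i = v -> used_parts (rcons dn i) K.
  move=> v2 Li w w1; rewrite has_rcons usd // Li.
  by case: eqP => // ew; lia.
apply: (@runs_seq _ 11 12) => //; apply: (@runs_le _ 11 Q1) => //.
  apply: runs_if => /=; rewrite /upd /= => Li; last first.
    apply: (runs_const ft) => [|{}ft]; first by lia.
    apply: runs_skip; eexists; eexists; exists K.
    split; [by []|by []|by []| |by split=> //; apply: (usd' 0)].
    by split; rewrite /upd //= /kept Li.
  apply: (@runs_sub _ _ _ _ _ _ _ _ ft _ _ _ (L i - 1)); [look|move=> {}ft].
  apply: (@runs_seq _ 8 1) => //; apply: runs_if => /=; rewrite /upd /= => Li1; last first.
    have Li_1 : L i = 1 by lia.
    apply: runs_skip; apply: runs_skip; eexists; eexists; exists K.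
    split; [by []|by []|by []| |by split=> //; apply: (usd' 1)].
    by split; rewrite /upd //= /kept Li_1.
  apply: (@runs_add _ _ _ _ _ _ _ _ ft _ _ _ (2 * L i)); [look|lia|move=> {}ft].
  apply: (@runs_add _ _ _ _ _ _ _ _ ft _ _ _ (4 * L i)); [look|lia|move=> {}ft].
  apply: (@runs_add _ _ _ _ _ _ _ _ ft _ _ _ (4 * L i + 3)); [look|lia|move=> {}ft].
  apply: (@runs_fetch _ _ _ _ _ _ _ _ ft _ _ (K (L i))); [by rewrite /upd /=|move=> {}ft].
  apply: (@runs_store _ _ _ _ _ _ _ _ ft _ _ (4 * L i + 3) 1); [look..|move=> {}ft].
  have Li2 : 1 < L i by lia.
  apply: runs_skip; apply: runs_skip; eexists; eexists; exists (upd K (L i) 1).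
  split; [by []|by []|by []| |split].
  - split; rewrite /upd //= usd // /kept (negPf Li) -edn.
    by have -> : L i != 1 by lia.
  - exact: layout_K lay _.
  move=> w w1; rewrite has_rcons /upd [w == _]eq_sym; case: eqP => // _.
  exact: usd.
move=> _ [R' [M' [K' [-> {}ft cs' [e6 e7 e14] [lay' usd2]]]]].
have [s0 s1 s2 s3 s4] := cs'; have [layU' layV' _ _] := lay' i.
have im : i < m by lia.
pose Q2 s' := exists R', [/\ s' = State R' M' ws (kept_words (rcons dn i)), fits B s', consts R'
    & R' 6 = (size rest).+1 /\ R' 7 = 4 * i + 2].
have kw : kept_words (rcons dn i) = kept_words dn ++ (if kept L i then [:: U i; V i] else [::]).
  rewrite /kept_words filter_rcons; case: ifP => _; last by rewrite cats0.
  by rewrite map_rcons flatten_rcons.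
apply: (@runs_seq _ 8 4) => //; apply: (@runs_le _ 8 Q2) => //.
  apply: runs_if => /=; rewrite e14 => kp; last first.
    apply: runs_skip; exists R'; split=> //.
    by rewrite kw; case: (kept L i) kp => //; rewrite cats0.
  apply: (@runs_sub _ _ _ _ _ _ _ _ ft _ _ _ (4 * i)); [look|move=> {}ft].
  apply: (@runs_fetch _ _ _ _ _ _ _ _ ft _ _ (U i)); [by rewrite /upd /=|move=> {}ft].
  apply: (@runs_write _ _ _ _ _ _ _ _ ft _ (U i)); [by rewrite /upd|move=> {}ft].
  apply: (@runs_add _ _ _ _ _ _ _ _ ft _ _ _ (4 * i + 1)); [look|lia|move=> {}ft].
  apply: (@runs_fetch _ _ _ _ _ _ _ _ ft _ _ (V i)); [by rewrite /upd /=|move=> {}ft].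
  apply: (@runs_write _ _ _ _ _ _ _ _ ft _ (V i)); [by rewrite /upd|move=> {}ft].
  rewrite /Q2 kw; case: (kept L i) kp => // _; rewrite -cat_rcons cats1.
  by apply: runs_skip; eexists; split; [by []|by []|by []|by []].
move=> _ [R2 [-> {}ft cs2 [f6 f7]]]; have [t0 t1 t2 t3 t4] := cs2.
apply: (@runs_add _ _ _ _ _ _ _ _ ft _ _ _ (4 * (size dn).+1 + 2)); [look|lia|move=> {}ft].
apply: (@runs_sub _ _ _ _ _ _ _ _ ft _ _ _ (size rest)); [look|move=> {}ft].
apply: runs_skip; eexists; eexists; exists K'; split; [by []|by []| | |by []].
- by split=> //; rewrite cat_rcons.
by split; rewrite /upd //= size_rcons.
Qed.

Lemma write_edgesP s : write_inv [::] (iota 0 m) s ->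
  runs B (While 6 write_edge) s (m * 25).+1 (write_inv (iota 0 m) [::]).
Proof.
move=> inv0.
have := @runs_for B _ 6 write_edge write_inv (fun=> 24) _ _ (iota 0 m) [::] s inv0.
rewrite sumn_map_const size_iota.
apply=> [dn i rest s1 h|dn s1 [R [M [K [-> _ _ [/= -> _] _]]]] //]; split.
  by case: h => R [M [K [-> _ _ [/= -> _] _]]].
exact: write_edgeP.
Qed.

End WriteEdges.

(** Each edge costs 9 units when it is read and 25 when it is written, loop tests included. *)
Definition program_time (pss : seq (seq (seq nat))) : nat :=
  m * 34 + sumn [seq (part_cost fs).+1 | fs <- pss] + 20.

Lemma spanner_programP n pss (L := label (part_occs 2 pss)) : 4 <= B -> n <= B ->
  all (fun d => (d.1 <= B) && (d.2 <= B)) es -> (size pss).+1 <= B ->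
  all (fun fs => (size fs <= B) &&
    all (fun f => (size f <= B) && all (fun i => 4 * i + 2 <= B) f) fs) pss ->
  (forall i, 4 * L i + 3 <= B) ->
  runs B spanner_program (init (n :: size es :: flatten [seq edge_words d | d <- es] ++
      size pss :: flatten [seq part_words fs | fs <- pss]))
    (program_time pss) (fun s => out s = kept_words L (iota 0 m)).
Proof.
move=> B4 nB esB pssB pB LB; rewrite /init.
set tail := size pss :: _.
have ft : fits B (State (fun=> 0) (fun=> 0)
    (n :: size es :: flatten [seq edge_words d | d <- es] ++ tail) [::]).
  by move=> i.
set S := sumn [seq (part_cost fs).+1 | fs <- pss].
have -> : program_time pss = 5 + (m * 34 + S + 15) by rewrite /program_time -/S; lia.
apply: (runs_seq (K1 := 5)) (leqnn _).
do 4!(apply: (runs_const ft); [lia|move=> {}ft]).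
apply: runs_skip.
have -> : m * 34 + S + 15 = (m * 34 + S + 12).+3 by lia.
apply: (runs_read ft) => // {}ft.
apply: (runs_read ft) => [|{}ft]; first by rewrite -/m; lia.
apply: (@runs_add _ _ _ _ _ _ _ _ ft _ _ _ m); [by rewrite /upd /= addn0|lia|move=> {}ft].
apply: (@runs_seq _ (m * 9).+1 (m * 25 + S + 11)); last by lia.
apply: (runs_le (read_edgesP (tail := tail) esB _)) => //.
  by eexists; eexists; split; [by []|by []|by []|by []|by move=> i; split; rewrite ?nth_nil].
move=> _ [R [M [-> {}ft [cs _] [r5 r6 r7 r11 r12] lay]]].
have -> : m * 25 + S + 11 = (m * 25 + S + 9).+2 by lia.
apply: (runs_read ft) => [|{}ft]; first by lia.
apply: (runs_const ft) => [|{}ft]; first by lia.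
apply: (@runs_seq _ S.+1 (m * 25 + 8)); last by lia.
rewrite -[flatten _]cats0; apply: (runs_le (read_partsP pssB pB _)) => //.
  by eexists; eexists; split; [by []|by []|by []|by []|by []].
move=> {cs lay r5 r6 r7 r11 r12} _ [{}R [{}M [-> {}ft cs [r5 _ _ _ _] lay]]].
have [r0 _ _ _ _] := cs.
have -> : m * 25 + 8 = (m * 25 + 6).+2 by lia.
apply: (@runs_add _ _ _ _ _ _ _ _ ft _ _ _ m); [by rewrite r0 r5 addn0|lia|move=> {}ft].
apply: (runs_const ft) => [|{}ft]; first by lia.
apply: (@runs_seq _ (m * 25).+1 5); last by lia.
apply: (runs_le (write_edgesP LB _)) => //.
  eexists; eexists; exists (fun=> 0); split; [by []|by []|by []| |by []].
  by split; rewrite /upd //= size_iota.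
by move=> _ [R' [M' [K [-> _ _ _ _]]]]; apply: runs_skip.
Qed.

End Program.

(** * Correctness of the labels *)

Lemma label_le occ i N : 0 < N -> all (fun o => o.1 <= N) occ -> label occ i <= N.
Proof.
move=> N0 /allP occN; rewrite /label.
suff gen q v : v <= N -> all (leq^~ N) q -> foldl relabel v q <= N.
  apply: gen => //; apply/allP => _ /mapP[o + ->].
  by rewrite mem_filter => /andP[_ /occN].
elim: q v => //= p q IH v vN /andP[pN qN].
by apply: IH => //; rewrite /relabel; case: ifP => // _; case: ifP.
Qed.

Lemma part_occs_lt p pss : all (fun o => o.1 < p + size pss) (part_occs p pss).
Proof.
elim: pss p => //= fs pss IH p; rewrite all_cat addnS -addSn IH andbT.
by apply/allP => _ /mapP[i _ ->] /=; rewrite addSn ltnS leq_addr.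
Qed.

Lemma uniq_flatten_sets (T : finType) (ss : seq (seq T)) :
  all uniq ss -> uniq [seq [set x in s] | s <- ss] ->
  (forall s s' x, s \in ss -> s' \in ss -> x \in s -> x \in s' ->
     [set y in s] = [set y in s']) ->
  uniq (flatten ss).
Proof.
elim: ss => //= s ss IH /andP[us uss] /andP[ns uS] eqS; rewrite cat_uniq us /=.
apply/andP; split; last first.
  by apply: IH => // s1 s2 x h1 h2; apply: eqS; rewrite inE ?h1 ?h2 orbT.
apply/hasPn => x /flattenP[s' s'ss xs']; apply: contra ns => /= xs.
by rewrite (eqS s s' x) ?mem_head ?inE ?s'ss ?orbT // map_f.
Qed.

Lemma part_occs_flatten (T U : eqType) (idx : U -> nat) (bd : T -> seq U) (pid : T -> nat) p
    (ps : seq (seq T)) :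
  (forall j f, j < size ps -> f \in nth [::] ps j -> pid f = p + j) ->
  part_occs p [seq [seq [seq idx x | x <- bd f] | f <- s] | s <- ps] =
  flatten [seq [seq (pid f, idx x) | x <- bd f] | f <- flatten ps].
Proof.
elim: ps p => //= s ps IH p pidP; rewrite map_cat flatten_cat; congr (_ ++ _).
  have := pidP 0; rewrite addn0 /= => /(_ _ isT) ps0.
  elim: s ps0 {IH pidP} => //= f s IH ps0; rewrite map_cat -map_comp.
  congr (_ ++ _); first by rewrite (ps0 f) ?mem_head.
  by apply: IH => g gs; apply: ps0; rewrite inE gs orbT.
by apply: IH => j f jp fj; rewrite (pidP j.+1) // addSnnS.
Qed.

(** A boundary list has no repetition, so a face contributes one occurrence of [x] or none; [index]
    separates the edges because all of them occur in [xs]. *)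
Lemma occ_parts (T U : eqType) (xs : seq U) (bd : T -> seq U) (pid : T -> nat) x (fl : seq T) :
  x \in xs -> (forall f, f \in fl -> uniq (bd f) /\ {subset bd f <= xs}) ->
  [seq o.1 | o <- flatten [seq [seq (pid f, index y xs) | y <- bd f] | f <- fl]
           & o.2 == index x xs] =
  [seq pid f | f <- fl & x \in bd f].
Proof.
move=> xxs; elim: fl => //= f fl IH bdP; rewrite filter_cat map_cat IH; last first.
  by move=> g gfl; apply: bdP; rewrite inE gfl orbT.
have [ubd sbd] := bdP f (mem_head _ _).
rewrite filter_map -map_comp (@eq_in_filter _ _ (pred1 x)); last first.
  move=> y /sbd yxs /=; apply/eqP/eqP => [|-> //] eq.
  by rewrite -(nth_index x yxs) eq nth_index.
have [xf|xf] := boolP (x \in bd f).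
  by rewrite filter_pred1_uniq.
have -> // : [seq y <- bd f | pred1 x y] = [::].
by apply/eqP; rewrite -size_eq0 size_filter -leqn0 leqNgt -has_count has_pred1.
Qed.

Lemma sum_part_cost (T : Type) (size_bd : T -> nat) (w : T -> seq nat) (ps : seq (seq T)) :
  (forall f, size (w f) = size_bd f) ->
  sumn [seq (part_cost fs).+1 | fs <- [seq [seq w f | f <- s] | s <- ps]] =
  sumn [seq size_bd f * 18 + 5 | f <- flatten ps] + size ps * 6.
Proof.
move=> sw; elim: ps => //= s ps ->; rewrite map_cat sumn_cat /part_cost -map_comp.
rewrite (@eq_map _ _ (_ \o _) (fun f => size_bd f * 18 + 5)); last by move=> f /=; rewrite sw.
by lia.
Qed.

(** * The algorithm on an encoded partition *)

Section Algorithm.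
Variables (n : nat) (e : rel 'I_n) (rot : 'I_n -> 'I_n -> 'I_n).
Variables (outer : {set 'I_n * 'I_n}) (pi : {set {set {set 'I_n * 'I_n}}}).
Variables (es : seq ('I_n * 'I_n)) (bd : {set 'I_n * 'I_n} -> seq {set 'I_n}).
Variable ps : seq (seq {set 'I_n * 'I_n}).
Hypothesis simple_e : simple_graph e.
Hypothesis conn2 : two_connected e.
Hypothesis outerplane_e : outerplane_embedding e rot outer.
Hypothesis pi_parts : tree_S_partition e rot outer pi.
Hypothesis es_edges : listing (edges e) [seq edge_of d | d <- es].
Hypothesis bdP : forall f, f \in int_faces e rot outer -> listing (face_edges f) (bd f).
Hypothesis ps_parts : listing2 pi ps.

Let xs := [seq edge_of d | d <- es].
Let Ps := [seq [set f in s] | s <- ps].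
Let fl := flatten ps.
Let int := int_faces e rot outer.
Let face := face_of rot.
Let m := size es.

Let rot_e : rotation_system e rot.
Proof. by have [[]] := outerplane_e. Qed.
Let euler : #|'I_n| + #|faces e rot| = #|edges e| + 2.
Proof. by have [[]] := outerplane_e. Qed.
Let outerF : outer \in faces e rot.
Proof. by have [] := outerplane_e. Qed.
Let pi_partition : partition pi int.
Proof. by have [] := pi_parts. Qed.
Let uniq_xs : uniq xs. Proof. by have [] := es_edges. Qed.
Let mem_xs : xs =i edges e. Proof. by have [] := es_edges. Qed.
Let uniq_Ps : uniq Ps. Proof. by have [_ []] := ps_parts. Qed.
Let mem_Ps : Ps =i pi. Proof. by have [_ []] := ps_parts. Qed.
Let uniq_ps : all uniq ps. Proof. by have [] := ps_parts. Qed.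

Definition index_parts : seq (seq (seq nat)) :=
  [seq [seq [seq index x xs | x <- bd f] | f <- s] | s <- ps].

Definition part_id (A : {set {set 'I_n * 'I_n}}) : nat := 2 + index A Ps.

Let L := label (part_occs 2 index_parts).
Let part_of := pblock pi.

Lemma mem_fl : fl =i int.
Proof.
move=> f; have /and3P[/eqP cov _ _] := pi_partition; rewrite -cov.
apply/flattenP/bigcupP => [[s sps fs]|[A]].
  by exists [set g in s]; rewrite ?inE // -mem_Ps map_f.
by rewrite -mem_Ps => /mapP[s sps ->]; rewrite inE => fs; exists s.
Qed.

Lemma part_of_seq s f : s \in ps -> f \in s -> part_of f = [set g in s].
Proof.
move=> sps fs; have /and3P[_ tI _] := pi_partition.
by apply: def_pblock; rewrite ?inE // -mem_Ps map_f.
Qed.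

Lemma uniq_fl : uniq fl.
Proof.
apply: uniq_flatten_sets => // s s' f sps s'ps fs fs'.
by rewrite -(part_of_seq sps fs) (part_of_seq s'ps fs').
Qed.

Lemma part_of_int f : f \in int -> part_of f \in pi /\ f \in part_of f.
Proof.
have /and3P[/eqP cov _ _] := pi_partition; rewrite -cov => fc.
by rewrite pblock_mem // mem_pblock.
Qed.

Lemma part_id_inj : {in pi &, injective part_id}.
Proof.
move=> A A' Api A'pi /eqP; rewrite eqn_add2l => /eqP eq.
by rewrite -(nth_index set0 (s := Ps) (x := A)) ?mem_Ps // eq nth_index ?mem_Ps.
Qed.

Lemma label_faces x : x \in edges e ->
  L (index x xs) = foldl relabel 0
    [seq part_id (part_of f) | f <- fl & x \in face_edges f].
Proof.
move=> xE; rewrite /L /label /index_parts.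
rewrite (@part_occs_flatten _ _ _ _ (fun f => part_id (part_of f))); last first.
  move=> j f jps fj; rewrite (part_of_seq (mem_nth _ jps) fj) /part_id; congr (_ + _).
  have <- : nth set0 Ps j = [set g in nth [::] ps j] by rewrite (nth_map [::]).
  by rewrite index_uniq ?size_map.
rewrite occ_parts ?mem_xs // => [|f].
  congr foldl; congr map; apply: eq_in_filter => f; rewrite mem_fl => fI.
  by have [_ ->] := bdP fI.
rewrite mem_fl => fI; have [ubd mbd] := bdP fI; split=> // y.
rewrite mbd mem_xs; apply: subsetP; apply: (face_edges_sub simple_e rot_e).
by case/setD1P: fI.
Qed.

(** In the inner case the boolean is read as the number 0 or 1. Since [part_id] is at least 2, the
    label tells the two cases apart. *)
Variant label_spec (x : {set 'I_n}) : nat -> Prop :=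
| LabelExternal f of f \in int & x \in face_edges f :&: face_edges outer :
    label_spec x (part_id (part_of f))
| LabelInner f g of f \in int & g \in int & f != g & x \in face_edges f :&: face_edges g :
    label_spec x (part_of f == part_of g).

(** The two sides of the edge are different faces, so at most one of them is the exterior face, and
    the edge is read once or twice, whatever the order of the faces. *)
Lemma labelP x : x \in edges e -> label_spec x (L (index x xs)).
Proof.
move=> xE; rewrite label_faces //; case/imsetP: xE => d dD ->.
have nf := face_flip simple_e rot_e conn2 euler dD.
set g := [seq f <- fl | _].
have gP f : f \in g = [&& f \in int & edge_of d \in face_edges f].
  by rewrite mem_filter mem_fl andbC.
have ug : uniq g by rewrite filter_uniq ?uniq_fl.
have sg : {subset g <= [:: face d; face (flip d)]}.
  move=> f; rewrite gP => /andP[/setD1P[_ fF]].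
  by case/(face_edges_dart simple_e rot_e fF) => ->; rewrite !inE eqxx ?orbT.
have dF c : c \in darts e -> edge_of c = edge_of d -> face c \in g \/ face c = outer.
  move=> cD ec; have [->|no] := eqVneq (face c) outer; [by right|left].
  by rewrite gP in_setD1 no face_in_faces // -ec imset_f // face_id.
have d1 := dF d dD erefl.
have d2 : face (flip d) \in g \/ face (flip d) = outer.
  by apply: dF; rewrite ?darts_flip ?edge_of_flip.
have outE : edge_of d \in face_edges outer <-> face d = outer \/ face (flip d) = outer.
  split=> [/(face_edges_dart simple_e rot_e outerF)[->|->]|[<-|<-]]; [by left|by right| |].
    by rewrite imset_f // face_id.
  by rewrite -edge_of_flip imset_f // face_id.
case eg: g => [|f [|f' [|f'' g']]].
- rewrite eg in d1 d2; case: d1 d2 => // o1 [] // o2.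
  by move: nf; rewrite [face_of _ _]o2 [face_of _ d]o1 eqxx.
- have := gP f; rewrite eg mem_head => /esym/andP[fI xf] /=; rewrite /relabel /=.
  apply: LabelExternal => //; rewrite inE xf; apply/outE.
  rewrite eg !inE in d1 d2; case: d1 => [/eqP o1|]; [right|by left].
  case: d2 => // /eqP o2; move: nf.
  by rewrite [face_of _ _]o2 [face_of _ d]o1 eqxx.
- have /andP[fI xf] : (f \in int) && (edge_of d \in face_edges f).
    by rewrite -gP eg mem_head.
  have /andP[f'I xf'] : (f' \in int) && (edge_of d \in face_edges f').
    by rewrite -gP eg inE mem_head orbT.
  rewrite eg /= in ug; case/andP: ug; rewrite inE => ff' _ /=.
  rewrite /relabel /= eqn_add2l.
  have -> : (index (part_of f) Ps == index (part_of f') Ps) = (part_of f == part_of f').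
    apply/eqP/eqP => [eq|-> //]; apply: part_id_inj; rewrite /part_id ?eq //.
      by have [] := part_of_int fI.
    by have [] := part_of_int f'I.
  have -> : (if part_of f == part_of f' then 1 else 0) = (part_of f == part_of f') :> nat.
    by case: ifP.
  by apply: LabelInner => //; rewrite inE xf.
by have := uniq_leq_size ug sg; rewrite eg.
Qed.

Lemma edge_two_faces x f g k : f \in faces e rot -> g \in faces e rot -> f != g ->
  x \in face_edges f :&: face_edges g -> k \in faces e rot -> x \in face_edges k ->
  k = f \/ k = g.
Proof.
move=> fF gF fg /setIP[xf xg] kF xk.
have [d dD [ed ex]] := face_edgesP simple_e rot_e _ kF xk; move: xf xg; rewrite ex.
case/(face_edges_dart simple_e rot_e fF) => e1; first by left; rewrite e1.
case/(face_edges_dart simple_e rot_e gF) => e2; first by right; rewrite e2.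
by move: fg; rewrite e1 e2 eqxx.
Qed.

Lemma external_not_inner x f g : f \in int -> g \in int -> f != g ->
  x \in face_edges f :&: face_edges g -> x \notin face_edges outer.
Proof.
move=> /setD1P[fo fF] /setD1P[go gF] fg xfg; apply/negP => xo.
have [eo|eo] := edge_two_faces fF gF fg xfg outerF xo.
  by rewrite eo eqxx in fo.
by rewrite eo eqxx in go.
Qed.

Lemma external_face_unique x f g : f \in int -> g \in int ->
  x \in face_edges f :&: face_edges outer -> x \in face_edges g -> f = g.
Proof.
move=> fI gI /setIP[xf xo] xg; apply/eqP; apply: contraTT xo => fg.
by apply: external_not_inner fI gI fg _; rewrite inE xf.
Qed.

Lemma label_external x f : f \in int -> x \in face_edges f :&: face_edges outer ->
  L (index x xs) = part_id (part_of f).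
Proof.
move=> fI xfo; have xE : x \in edges e.
  by case/setIP: xfo => _; apply: subsetP; apply: (face_edges_sub simple_e rot_e).
case: (labelP xE) => [g gI /setIP[xg xo]|g h gI hI gh xgh].
  by rewrite (external_face_unique fI gI xfo xg).
by case/setIP: xfo => _; rewrite (negPf (external_not_inner gI hI gh xgh)).
Qed.

Lemma label_shared x A : A \in pi -> x \in shared_edges A -> L (index x xs) = 1.
Proof.
have /and3P[_ tI _] := pi_partition.
move=> Api; rewrite inE => /exists_inP[f fA] /exists_inP[g gA] /andP[fg xfg].
have sA := part_sub pi_partition Api.
have [fI gI] := (subsetP sA _ fA, subsetP sA _ gA).
have xE : x \in edges e.
  case/setIP: xfg => xf _; apply: subsetP xf; apply: (face_edges_sub simple_e rot_e).
  by case/setD1P: fI.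
have := external_not_inner fI gI fg xfg.
case: (labelP xE) => [k kI /setIP[_ ->] //|k h kI hI kh xkh _].
have [fF gF kF hF] : [/\ f \in faces e rot, g \in faces e rot,
    k \in faces e rot & h \in faces e rot].
  by move: fI gI kI hI => /setD1P[_ ?] /setD1P[_ ?] /setD1P[_ ?] /setD1P[_ ?].
suff pA l : l \in faces e rot -> x \in face_edges l -> part_of l = A.
  by case/setIP: xkh => xk xh; rewrite !pA // eqxx.
by move=> lF xl; case: (edge_two_faces fF gF fg xfg lF xl) => ->; apply: def_pblock.
Qed.

(** The external edge of a part that the program drops: the one of least index, found through its
    label. *)
Definition first_external (A : {set {set 'I_n * 'I_n}}) : {set 'I_n} :=
  nth set0 xs (find (fun i => L i == part_id A) (iota 0 m)).

Let size_xs : size xs = m. Proof. by rewrite size_map. Qed.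

Let nth_xs i : i < m -> nth set0 xs i \in edges e /\ index (nth set0 xs i) xs = i.
Proof. by move=> im; rewrite -mem_xs mem_nth ?index_uniq ?size_xs. Qed.

Lemma label_part A i : A \in pi -> i < m -> L i = part_id A ->
  exists2 f, f \in A & nth set0 xs i \in face_edges f :&: face_edges outer.
Proof.
move=> Api im eL; have [xE ix] := nth_xs im; move: eL; rewrite -{1}ix.
case: (labelP xE) => [f fI xfo|f g _ _ _ _]; last by case: (_ == _).
have [Bpi fB] := part_of_int fI.
by move/(part_id_inj Bpi Api) => <-; exists f.
Qed.

Lemma first_externalP A : A \in pi -> exists i, [/\ i < m, L i = part_id A,
  forall j, j < i -> L j != part_id A & first_external A = nth set0 xs i].
Proof.
move=> Api; have [_ _ /(_ _ Api)[_ /eqP/cards1P[f /setP/(_ f)]]] := pi_parts.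
rewrite in_setI set11 => /andP[fA]; rewrite inE => /andP[fI /set0Pn[x xfo]].
have xE : x \in edges e.
  by case/setIP: xfo => _; apply: subsetP; apply: (face_edges_sub simple_e rot_e).
have /and3P[_ tI _] := pi_partition.
have Lx : L (index x xs) = part_id A.
  by rewrite (label_external fI xfo) /part_of (def_pblock tI Api fA).
have xm : index x xs < m by rewrite -size_xs index_mem mem_xs.
have hA : has (fun i => L i == part_id A) (iota 0 m).
  by apply/hasP; exists (index x xs); rewrite ?mem_iota ?Lx.
have := hA; rewrite has_find size_iota => km.
exists (find (fun i => L i == part_id A) (iota 0 m)); split=> // [|j jk].
  by have /eqP := nth_find 0 hA; rewrite nth_iota.
have := before_find 0 jk; rewrite nth_iota ?add0n => [->|] //.
exact: ltn_trans jk km.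
Qed.

(** Part numbers are injective and differ from 0 and 1, so the label decides whether an edge can be
    removed as shared within a part or only as the first external edge of one. *)
Lemma kept_removed i : i < m ->
  kept L i = (nth set0 xs i \notin removed_edges pi first_external).
Proof.
move=> im; have [xE ix] := nth_xs im; set x := nth set0 xs i in xE ix *.
have remP : x \in removed_edges pi first_external ->
    L i = 1 \/ exists2 A, A \in pi & L i = part_id A /\ forall j, j < i -> L j != L i.
  case/bigcupP => A Api; rewrite in_setU1 => /predU1P[ex|xA]; last first.
    by left; rewrite -ix; apply: label_shared xA.
  right; exists A => //; have [k [km Lk kmin ek]] := first_externalP Api.
  have -> : i = k by rewrite -ix ex ek index_uniq ?size_xs.
  by split=> // j /kmin; rewrite Lk.
have inner : L i = 1 -> x \in removed_edges pi first_external.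
  rewrite -ix; case: (labelP xE) => [f _ _ //|f g fI gI fg xfg].
  case: eqP => // eqA _; have [Api fA] := part_of_int fI; have [_ gA] := part_of_int gI.
  apply/bigcupP; exists (part_of f) => //; rewrite in_setU1; apply/orP; right.
  rewrite inE; apply/exists_inP; exists f => //; apply/exists_inP; exists g; first by rewrite eqA.
  by rewrite fg.
have [L0|L0] := eqVneq (L i) 0.
  rewrite /kept L0; apply/esym/negP => /remP[|[A _ []]]; rewrite L0 //.
have [L1|L1] := eqVneq (L i) 1; first by rewrite inner // /kept L1.
rewrite /kept (negPf L0) L1 /=.
apply/hasP/idP => [[j]|]; rewrite ?mem_iota /=.
  move=> ji /eqP eL; apply/negP => /remP[Li1|[A _ [_ /(_ j ji)]]]; first by rewrite Li1 in L1.
  by rewrite eL eqxx.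
move=> xrem; have [A Api LA] : exists2 A, A \in pi & L i = part_id A.
  move: L0 L1; rewrite -ix; case: (labelP xE) => [f fI _ _ _|f g _ _ _ _]; last first.
    by case: (part_of f == part_of g).
  by have [Api _] := part_of_int fI; exists (part_of f).
have [k [km Lk kmin ek]] := first_externalP Api.
have [ki|ik|eik] := ltngtP k i.
- by exists k; rewrite ?mem_iota // Lk LA.
- by have := kmin _ ik; rewrite LA eqxx.
case/negP: xrem; apply/bigcupP; exists A => //.
by rewrite in_setU1 ek eik eqxx.
Qed.

Definition edge_pair (d : 'I_n * 'I_n) : nat * nat := (val d.1, val d.2).

Lemma encodeE : encode es bd ps =
  n :: size [seq edge_pair d | d <- es] ::
    flatten [seq edge_words d | d <- [seq edge_pair d | d <- es]] ++
    size index_parts :: flatten [seq part_words fs | fs <- index_parts].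
Proof.
rewrite /encode /prefixed !size_map -!map_comp /=; congr [:: _, _ & _ ++ _ :: flatten _].
apply: eq_map => s; rewrite /= /part_words size_map -map_comp; congr (_ :: flatten _).
apply: eq_map => f; rewrite /= /face_words /prefixed /list_words size_map.
by rewrite flatten_map1.
Qed.

Definition spanner_pairs : seq ('I_n * 'I_n) :=
  [seq d <- es | edge_of d \notin removed_edges pi first_external].

Lemma kept_wordsE : kept_words [seq edge_pair d | d <- es] L (iota 0 m) =
  flatten [seq pair_words d | d <- spanner_pairs].
Proof.
rewrite /kept_words /spanner_pairs; congr flatten.
case ees: es => [|d0 es']; first by rewrite /m ees.
rewrite -ees -{2}(mkseq_nth d0 es) /mkseq -/m filter_map -map_comp.
rewrite (@eq_in_filter _ _ (preim (nth d0 es)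
   [pred d | edge_of d \notin removed_edges pi first_external])).
  apply/eq_in_map => i; rewrite mem_filter mem_iota => /andP[_ im].
  by rewrite /= (nth_map d0).
move=> i; rewrite mem_iota => im; rewrite kept_removed //=.
by rewrite (nth_map d0).
Qed.

Lemma spanner_pairs_listing : listing (edges e :\: removed_edges pi first_external)
  [seq edge_of d | d <- spanner_pairs].
Proof.
have -> : [seq edge_of d | d <- spanner_pairs] =
    [seq x <- xs | x \notin removed_edges pi first_external].
  by rewrite filter_map.
by split=> [|x]; [rewrite filter_uniq | rewrite mem_filter inE mem_xs].
Qed.

Lemma first_external_part A : A \in pi ->
  exists2 f, f \in A & first_external A \in face_edges f :&: face_edges outer.
Proof.
move=> Api; have [k [km Lk _ ->]] := first_externalP Api.
exact: label_part.
Qed.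

Lemma first_external_spanner t : 0 < t -> cost pi <= t - 1 ->
  tree_spanner e t (edges e :\: removed_edges pi first_external).
Proof.
apply: (removed_edges_spanner simple_e conn2 outerplane_e pi_partition) => [A|A].
  by have [_ _ h] := pi_parts; case/h.
exact: first_external_part.
Qed.

(** * Linear bounds on time and word size *)

Let n2 : 2 < n. Proof. by have [] := conn2; rewrite card_ord. Qed.

Lemma size_es : m <= 3 * n.
Proof.
have := edges_card simple_e rot_e conn2 euler; rewrite card_ord; apply: leq_trans.
by rewrite -size_xs -(card_uniqP uniq_xs) (eq_card mem_xs).
Qed.

Lemma card_int : #|int| <= 2 * n.
Proof.
have := faces_card simple_e rot_e conn2 euler; rewrite card_ord; apply: leq_trans.
by apply/subset_leq_card/subsetDl.
Qed.

Lemma size_fl : size fl = #|int|.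
Proof. by rewrite -(card_uniqP uniq_fl) (eq_card mem_fl). Qed.

(** The blocks of a partition are non-empty, so there are at most as many parts as interior
    faces. *)
Lemma size_ps : size ps <= 2 * n.
Proof.
apply: leq_trans card_int; rewrite -size_fl size_flatten.
have ne s : s \in ps -> 0 < size s.
  move=> sps; have /and3P[_ _] := pi_partition; rewrite -mem_Ps; case: s sps => // sps.
  by case/mapP; exists [::] => //; apply/setP => f; rewrite !inE.
elim: (ps) ne => //= s l IH ne; rewrite -add1n leq_add ?ne ?mem_head //.
by apply: IH => s' s'l; apply: ne; rewrite inE s'l orbT.
Qed.

Lemma size_bd f : f \in int -> size (bd f) = #|face_edges f|.
Proof. by move=> /bdP[u eq]; rewrite -(card_uniqP u) (eq_card eq). Qed.

Lemma spanner_program_time :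
  program_time [seq edge_pair d | d <- es] index_parts <= 252 * n.
Proof.
rewrite /program_time size_map -/m.
rewrite /index_parts (@sum_part_cost _ (fun f => size (bd f))); last by move=> f; rewrite size_map.
have -> : sumn [seq size (bd f) * 18 + 5 | f <- flatten ps] =
    (\sum_(f in int) #|face_edges f|) * 18 + #|int| * 5.
  rewrite sumnE big_map big_uniq ?uniq_fl //= -sum_nat_const big_distrl -big_split /=.
  by rewrite (eq_bigl _ _ mem_fl); apply: eq_bigr => f /size_bd ->.
have := face_edges_sum simple_e rot_e conn2 euler (subsetDl _ _ : int \subset faces e rot).
rewrite card_ord.
(* The factors add up to [34 * 3 + 18 * 6 + 5 * 2 + 6 * 2 = 232], and the additive constant 20 is
   absorbed in [20 * n]. *)
have arith (a b c d : nat) : a <= 3 * n -> b <= 2 * n -> c <= 2 * n -> 2 < n ->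
  d <= 6 * n -> a * 34 + (d * 18 + b * 5 + c * 6) + 20 <= 252 * n by clear; lia.
exact: arith size_es card_int size_ps n2.
Qed.

(** Edge addresses stay below about [12 * n] and the addresses of marks below about [8 * n]. The
    factor [27 = 3 ^ 3] leaves room for both and is at most [n ^ 3] when [n] is at least 3. *)
Lemma spanner_program_run B : 27 * n <= B ->
  runs B spanner_program (init (encode es bd ps)) (252 * n)
    (fun s => out s = flatten [seq pair_words d | d <- spanner_pairs]).
Proof.
move=> nB; rewrite encodeE -kept_wordsE.
have [[[h1 h2] h3] h4] := (size_es, card_int, size_ps, n2).
have b1 : 4 * size [seq edge_pair d | d <- es] + 4 <= B.
  by rewrite size_map -/m; clear -h1 h4 nB; lia.
suff [p1 p2 p3 [p4 p5 p6]] : [/\ 4 <= B, n <= B,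
    all (fun d => (d.1 <= B) && (d.2 <= B)) [seq edge_pair d | d <- es] &
    [/\ (size index_parts).+1 <= B,
      all (fun fs => (size fs <= B) &&
        all (fun f => (size f <= B) && all (fun i => 4 * i + 2 <= B) f) fs) index_parts &
      forall i, 4 * label (part_occs 2 index_parts) i + 3 <= B]].
  apply: (runs_le (spanner_programP b1 p1 p2 p3 p4 p5 p6) spanner_program_time).
  by move=> s'; rewrite size_map.
split; [| | |split].
- by clear -h4 nB; lia.
- by clear -h4 nB; lia.
- apply/allP => _ /mapP[d _ ->] /=.
  by apply/andP; split; apply: leq_trans (ltnW (ltn_ord _)) _; clear -nB; lia.
- by rewrite size_map; clear -h3 h4 nB; lia.
- apply/allP => _ /mapP[s sps ->]; rewrite size_map; apply/andP; split.
    have : size s <= size fl.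
      rewrite /fl; elim: (ps) sps => //= s' l IH; rewrite inE size_cat => /predU1P[->|/IH].
        exact: leq_addr.
      by move/leq_trans; apply; apply: leq_addl.
    move/leq_trans; apply; rewrite size_fl; apply: leq_trans h2 _.
    by clear -nB; lia.
  apply/allP => _ /mapP[f fs ->]; rewrite size_map.
  have fI : f \in int by rewrite -mem_fl; apply/flattenP; exists s.
  have subE : face_edges f \subset edges e.
    by apply: (face_edges_sub simple_e rot_e); case/setD1P: fI.
  have cE : #|edges e| = m by rewrite -size_xs -(card_uniqP uniq_xs) (eq_card mem_xs).
  apply/andP; split.
    rewrite size_bd //; have := subset_leq_card subE; rewrite cE.
    by move/leq_trans; apply; clear -h1 nB; lia.
  apply/allP => _ /mapP[x xf ->].
  have : index x xs < m.
    by rewrite -size_xs index_mem mem_xs (subsetP subE) //; have [_ <-] := bdP fI.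
  by clear -h1 nB; lia.
- move=> i; have : label (part_occs 2 index_parts) i <= 2 + size ps.
    apply: label_le => //; have := part_occs_lt 2 index_parts.
    by apply: sub_all => o; rewrite size_map; apply: ltnW.
  by clear -h3 h4 nB; lia.
Qed.

End Algorithm.

Theorem theorem4 :
  exists (prog : com) (C : nat),
  forall (n : nat) (e : rel 'I_n) (rot : 'I_n -> 'I_n -> 'I_n)
         (outer : {set 'I_n * 'I_n}) (t : nat)
         (pi : {set {set {set 'I_n * 'I_n}}})
         (es : seq ('I_n * 'I_n))
         (bd : {set 'I_n * 'I_n} -> seq {set 'I_n})
         (ps : seq (seq {set 'I_n * 'I_n})),
    simple_graph e ->
    two_connected e ->
    outerplane_embedding e rot outer ->
    0 < t ->
    tree_S_partition e rot outer pi ->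
    cost pi <= t - 1 ->
    listing (edges e) [seq edge_of d | d <- es] ->
    (forall f, f \in int_faces e rot outer -> listing (face_edges f) (bd f)) ->
    listing2 pi ps ->
    exists (k : nat) (s : state) (F : {set {set 'I_n}})
           (fs : seq ('I_n * 'I_n)),
      [/\ exec (n ^ C) prog (init (encode es bd ps)) k s,
          k <= C * n,
          out s = flatten [seq pair_words d | d <- fs],
          listing F [seq edge_of d | d <- fs]
        & tree_spanner e t F].
Proof.
(* The factor of the running time also serves as the exponent of the word bound, where any value
   from 4 on suffices. *)
exists spanner_program, 252 => n e rot outer t pi es bd ps.
move=> simple_e conn2 outerplane_e t0 pi_parts cost_t es_edges bdP ps_parts.
have n2 : 2 < n by have [] := conn2; rewrite card_ord.
have nB : 27 * n <= n ^ 252.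
  apply: (@leq_trans (n ^ 4)); last by rewrite leq_pexp2l // ltnW // ltnW.
  by rewrite expnSr leq_mul2r -[27]/(3 ^ 3) leq_exp2r // n2 orbT.
have [k [s [run_s time_s out_s]]] := spanner_program_run simple_e conn2
  outerplane_e pi_parts es_edges bdP ps_parts nB.
exists k, s, (edges e :\: removed_edges pi (first_external es bd ps)),
  (spanner_pairs pi es bd ps).
split=> //.
  exact: spanner_pairs_listing.
exact: (first_external_spanner simple_e conn2 outerplane_e pi_parts es_edges bdP
  ps_parts t0 cost_t).
Qed.
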